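(* Let $f:\mathbb{R}^n\to\mathbb{R}^n$ be a continuous mapping and let $Jf:\mathbb{R}^n\rightrightarrows\mathcal{L}(\mathbb{R}^n,\mathbb{R}^n)$ be a pseudo-Jacobian map of $f$ which is upper semicontinuous at every point of $\mathbb{R}^n$. Let $x_0\in\mathbb{R}^n$ and $\rho>0$, and suppose that there exists a Riemann-integrable function $\eta:[0,\rho)\to(0,\infty)$ such that $$0<\eta(t)\le\inf_{\|x-x_0\|=t}\alpha_{Jf}(x)\quad\text{for } 0\le t<\rho.$$ Let $\sigma=\int_0^\rho\eta(t)\,dt$. Then $f(x_0+\rho\mathbf{B}_n)\supset f(x_0)+\sigma\mathbf{B}_n$, and $f$ admits a local inverse at $x_0$ defined in the open ball $V:=f(x_0)+\sigma\mathbf{B}_n$; that is, there exist a neighborhood $U$ of $x_0$ and a continuous mapping $g:V\to\mathbb{R}^n$ such that $f(U)\subset V$, $g(f(x))=x$ for every $x\in U$, and $f(g(y))=y$ for every $y\in V$.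
   Context: $\mathbb{R}^n$ carries the Euclidean norm, with open unit ball $\mathbf{B}_n$; $\mathcal{L}(\mathbb{R}^n,\mathbb{R}^n)$ is the space of linear maps ($n\times n$ matrices) with the usual operator norm, with open unit ball $\mathbf{B}_{n\times n}$; $co$ denotes convex hull. Pseudo-Jacobian: for $f:\mathbb{R}^n\to\mathbb{R}^n$ continuous, a nonempty closed set $Jf(x)\subset\mathcal{L}(\mathbb{R}^n,\mathbb{R}^n)$ is a pseudo-Jacobian of $f$ at $x$ if for all $u,v\in\mathbb{R}^n$, $(vf)^+(x;u)\le\sup_{M\in Jf(x)}\langle v,Mu\rangle$ (in the extended reals), where $(vf)(y)=\sum_{i=1}^n v_if_i(y)$ and $(vf)^+(x;u)=\limsup_{t\to0^+}\frac{(vf)(x+tu)-(vf)(x)}{t}$. A set-valued map $Jf:x\mapsto Jf(x)$ is a pseudo-Jacobian map of $f$ if $Jf(x)$ is a pseudo-Jacobian of $f$ at $x$ for every $x\in\mathbb{R}^n$. For a set $S\subset\mathbb{R}^n$, $Jf(S)=\bigcup_{x\in S}Jf(x)$. Upper semicontinuity: $Jf$ is upper semicontinuous at $x$ if for every $\varepsilon>0$ there is $\delta>0$ with $Jf(x+\delta\mathbf{B}_n)\subseteq Jf(x)+\varepsilon\mathbf{B}_{n\times n}$. Regularity index: the co-norm of a matrix $A$ is $/\!/A/\!/=\inf_{\|u\|=1}\|Au\|$, and $\alpha_{Jf}(x)=\inf\{/\!/A/\!/ : A\in co(Jf(x))\}$. *)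

(* Defs.v *)
From Stdlib Require Import Rdefinitions.
From mathcomp Require Import all_boot all_order all_algebra.
From mathcomp Require Import all_classical all_reals all_analysis.
From mathcomp Require Import Rstruct Rstruct_topology.
From Coquelicot Require Hierarchy RInt_gen.

Set Implicit Arguments.
Unset Strict Implicit.
Unset Printing Implicit Defensive.

Import Order.TTheory GRing.Theory Num.Theory.
Import numFieldNormedType.Exports.

Local Open Scope classical_set_scope.
Local Open Scope ring_scope.

(* MathComp-Analysis is used over Stdlib's R (a realType through Rstruct), so
   that the Riemann integral can be taken from Coquelicot. Vectors are columns
   and linear maps are square matrices. The library norm on matrices is the
   sup norm, hence the Euclidean and operator norms below; the topology is the
   same. *)

Definition dotv n (u v : 'cV[R]_n) : R := \sum_i u i 0 * v i 0.

Definition enorm n (u : 'cV[R]_n) : R := Num.sqrt (dotv u u).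

Definition eball n (c : 'cV[R]_n) (r : R) : set 'cV[R]_n :=
  [set x | enorm (x - c) < r].

Definition opnorm n (A : 'M[R]_n) : R :=
  sup [set enorm (A *m u) | u in [set u | enorm u <= 1]].

Definition opball n (A : 'M[R]_n) (r : R) : set 'M[R]_n :=
  [set B | opnorm (B - A) < r].

Definition convex_hull (V : lmodType R) (S : set V) : set V :=
  [set A | exists (k : nat) (l : 'I_k -> R) (B : 'I_k -> V),
     [/\ forall i, 0 <= l i, \sum_i l i = 1, forall i, S (B i)
       & A = \sum_i l i *: B i]].

Definition upper_dini n (f : 'cV[R]_n -> 'cV[R]_n) (v x u : 'cV[R]_n) : \bar R :=
  limf_esup (fun t : R => ((dotv v (f (x + t *: u)) - dotv v (f x)) / t)%:E)
            (0 : R)^'+.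

Definition pseudo_jacobian_at n (f : 'cV[R]_n -> 'cV[R]_n) (x : 'cV[R]_n)
    (J : set 'M[R]_n) : Prop :=
  [/\ J !=set0, closed J
    & forall u v : 'cV[R]_n,
        (upper_dini f v x u <= ereal_sup [set (dotv v (M *m u))%:E | M in J])%E].

Definition pseudo_jacobian_map n (f : 'cV[R]_n -> 'cV[R]_n)
    (Jf : 'cV[R]_n -> set 'M[R]_n) : Prop :=
  forall x, pseudo_jacobian_at f x (Jf x).

Definition usc_at n (Jf : 'cV[R]_n -> set 'M[R]_n) (x : 'cV[R]_n) : Prop :=
  forall eps : R, 0 < eps -> exists2 delta : R, 0 < delta &
    \bigcup_(y in eball x delta) Jf y `<=` \bigcup_(M in Jf x) opball M eps.

(* Infima are taken in the extended reals: they are finite when n > 0, and +oo,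
   the infimum of the empty set, when n = 0. *)
Definition conorm n (A : 'M[R]_n) : \bar R :=
  ereal_inf [set (enorm (A *m u))%:E | u in [set u | enorm u = 1]].

Definition regularity_index n (Jf : 'cV[R]_n -> set 'M[R]_n) (x : 'cV[R]_n) :
    \bar R :=
  ereal_inf [set conorm A | A in convex_hull (Jf x)].

(* h is Riemann integrable on [a, b[ with integral s: h is Riemann integrable on
   [a, r] for r < b close to b, and these integrals tend to s as r -> b-. The
   values of h outside [a, b[ are irrelevant. For h Riemann integrable (hence
   bounded) on [a, b] in the usual sense this is the usual integral. *)
Definition is_Riemann_integral_co (h : R -> R) (a b s : R) : Prop :=
  @RInt_gen.is_RInt_gen Hierarchy.R_NormedModule h
    (@Hierarchy.at_point Hierarchy.R_UniformSpace a) (Hierarchy.at_left b) s.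

(* g stands for a map V -> R^n; its values outside V are irrelevant. *)
Definition has_local_inverse_on n (f : 'cV[R]_n -> 'cV[R]_n) (x0 : 'cV[R]_n)
    (V : set 'cV[R]_n) : Prop :=
  exists (U : set 'cV[R]_n) (g : 'cV[R]_n -> 'cV[R]_n),
    [/\ nbhs x0 U, {within V, continuous g}, f @` U `<=` V,
        forall x, U x -> g (f x) = x
      & forall y, V y -> f (g y) = y].

(* Main.v *)
(* At a point x with index alpha(x) > a, separating {M u : M in co Jf(x)} from
   the ball of radius a yields for every displacement u a unit vector v with
   <v, M u> >= a |u|; by upper semicontinuity and a mean value inequality for
   Dini derivatives, <v, f(p + u) - f(p)> >= a |u| for all p and p + u near x.
   Hence f is locally injective with expansion constant a. This condition is
   linear in f, hence inherited by Steklov averages of f, which are C^1 with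
   invertible derivative; minimising |F - y| for such an average F and letting
   the averaging width tend to 0 shows that f is also locally open, although f
   need not be Lipschitz.

   A segment issued from f(x0) of length r < sigma is lifted in finitely many
   short steps. Choose Psi, a primitive of a lower Darboux step function of eta
   with Psi(t) > r for some t < rho. The local expansion makes Psi(|x - x0|) grow
   along the lift no faster than the length of the segment, so the lift stays in
   the ball of radius t, where step sizes are uniform by compactness. Lifts are
   unique, hence their endpoints define the inverse on the whole ball; that the
   ball is nonempty (sigma > 0) is Baire's theorem applied to the sets
   {eta >= 1/k}. *)

Require Import Defs.
From Stdlib Require Import Rdefinitions.
From mathcomp Require Import all_boot all_order all_algebra.
From mathcomp Require Import all_classical all_reals all_analysis.
From mathcomp Require Import Rstruct Rstruct_topology.
From mathcomp Require Import ring lra.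
From Coquelicot Require Rcomplements Hierarchy RInt SF_seq.

Set Implicit Arguments.
Unset Strict Implicit.
Unset Printing Implicit Defensive.

Import Order.TTheory GRing.Theory Num.Theory.
Import numFieldNormedType.Exports.

Local Open Scope classical_set_scope.
Local Open Scope ring_scope.

(** * Euclidean inner product and norm, and their comparison with the sup norm *)

Lemma dotvC n (u v : 'cV[R]_n) : dotv u v = dotv v u.
Proof. by apply: eq_bigr => i _; rewrite mulrC. Qed.

Lemma dotvDl n (u v w : 'cV[R]_n) : dotv (u + v) w = dotv u w + dotv v w.
Proof. by rewrite -big_split; apply: eq_bigr => i _; rewrite mxE mulrDl. Qed.

Lemma dotvZl n a (u v : 'cV[R]_n) : dotv (a *: u) v = a * dotv u v.
Proof. by rewrite mulr_sumr; apply: eq_bigr => i _; rewrite mxE mulrA. Qed.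

Lemma dotvNl n (u v : 'cV[R]_n) : dotv (- u) v = - dotv u v.
Proof. by rewrite -scaleN1r dotvZl mulN1r. Qed.

Lemma dotvDr n (u v w : 'cV[R]_n) : dotv w (u + v) = dotv w u + dotv w v.
Proof. by rewrite dotvC dotvDl !(dotvC w). Qed.

Lemma dotvZr n a (u v : 'cV[R]_n) : dotv u (a *: v) = a * dotv u v.
Proof. by rewrite dotvC dotvZl dotvC. Qed.

Lemma dotvNr n (u v : 'cV[R]_n) : dotv u (- v) = - dotv u v.
Proof. by rewrite dotvC dotvNl dotvC. Qed.

Lemma dotvBr n (u v w : 'cV[R]_n) : dotv w (u - v) = dotv w u - dotv w v.
Proof. by rewrite dotvDr dotvNr. Qed.

Lemma dotv_sqrD n (u v : 'cV[R]_n) :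
  dotv (u + v) (u + v) = dotv u u + 2 * dotv u v + dotv v v.
Proof. by rewrite !(dotvDl, dotvDr) (dotvC v u); ring. Qed.

Lemma dotvv_ge0 n (u : 'cV[R]_n) : 0 <= dotv u u.
Proof. by apply: sumr_ge0 => i _; rewrite -expr2 sqr_ge0. Qed.

Lemma enorm_ge0 n (u : 'cV[R]_n) : 0 <= enorm u.
Proof. exact: sqrtr_ge0. Qed.

Lemma sqr_enorm n (u : 'cV[R]_n) : enorm u ^+ 2 = dotv u u.
Proof. by rewrite sqr_sqrtr // dotvv_ge0. Qed.

Lemma enormZ n a (u : 'cV[R]_n) : enorm (a *: u) = `|a| * enorm u.
Proof.
by rewrite /enorm dotvZl dotvZr mulrA -expr2 sqrtrM ?sqr_ge0 // sqrtr_sqr.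
Qed.

Lemma enormN n (u : 'cV[R]_n) : enorm (- u) = enorm u.
Proof. by rewrite -scaleN1r enormZ normrN1 mul1r. Qed.

Lemma enorm0 n : enorm (0 : 'cV[R]_n) = 0.
Proof. by rewrite -(scale0r 0) enormZ normr0 mul0r. Qed.

Lemma coord_le_enorm n (u : 'cV[R]_n) i : `|u i 0| <= enorm u.
Proof.
rewrite -sqrtr_sqr ler_sqrt ?dotvv_ge0 // /dotv (bigD1 i) //= expr2 lerDl.
by apply: sumr_ge0 => j _; rewrite -expr2 sqr_ge0.
Qed.

Lemma enorm_eq0 n (u : 'cV[R]_n) : (enorm u == 0) = (u == 0).
Proof.
apply/eqP/eqP => [u0|->]; last exact: enorm0.
apply/colP => i; rewrite mxE; apply/eqP.
by rewrite -normr_le0 -u0 coord_le_enorm.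
Qed.

Lemma enorm_gt0 n (u : 'cV[R]_n) : (0 < enorm u) = (u != 0).
Proof. by rewrite lt_neqAle enorm_ge0 andbT eq_sym enorm_eq0. Qed.

(** Cauchy-Schwarz: the vector [dotv v v *: u - dotv u v *: v] has squared norm
    [b * (a * b - c ^+ 2)], which is nonnegative. *)
Lemma dotv_le_enorm n (u v : 'cV[R]_n) : dotv u v <= enorm u * enorm v.
Proof.
have [->|v0] := eqVneq v 0.
  by rewrite enorm0 mulr0 -(scale0r 0) dotvZr mul0r.
have v_gt0 : 0 < dotv v v by rewrite -sqr_enorm exprn_gt0 // enorm_gt0.
have := dotvv_ge0 (dotv v v *: u - dotv u v *: v).
rewrite !(dotvDl, dotvDr, dotvNl, dotvNr, dotvZl, dotvZr) (dotvC v u).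
set a := dotv u u; set b := dotv v v; set c := dotv u v => h.
have {}h : 0 <= b * (a * b - c ^+ 2).
  by apply: le_trans h _; rewrite le_eqVlt; apply/orP; left; apply/eqP; ring.
rewrite pmulr_rge0 // subr_ge0 in h.
apply: le_trans (ler_norm _) _; rewrite -sqrtr_sqr -sqrtrM ?dotvv_ge0 //.
exact: ler_wsqrtr.
Qed.

Lemma enormD n (u v : 'cV[R]_n) : enorm (u + v) <= enorm u + enorm v.
Proof.
rewrite -(@ler_pXn2r _ 2) ?nnegrE ?addr_ge0 ?enorm_ge0 //.
rewrite sqr_enorm !(dotvDl, dotvDr) sqrrD !sqr_enorm (dotvC v u).
have := dotv_le_enorm u v; lra.
Qed.

Lemma enorm_distC n (u v : 'cV[R]_n) : enorm (u - v) = enorm (v - u).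
Proof. by rewrite -enormN opprB. Qed.

Lemma enorm_distD n (w u v : 'cV[R]_n) :
  enorm (u - v) <= enorm (u - w) + enorm (w - v).
Proof. by apply: le_trans (enormD _ _); rewrite addrA subrK. Qed.

Lemma norm_le_coord n (u : 'cV[R]_n) e : 0 <= e ->
  (forall i, `|u i 0| <= e) -> `|u| <= e.
Proof.
move=> e0 h; rewrite [leLHS]/Num.norm /= mx_normrE.
by apply: bigmax_le => // -[i j] _ /=; rewrite (ord1 j).
Qed.

Lemma norm_le_enorm n (u : 'cV[R]_n) : `|u| <= enorm u.
Proof. by apply: norm_le_coord (enorm_ge0 _) _ => i; exact: coord_le_enorm. Qed.

Lemma coord_le_norm n (u : 'cV[R]_n) i : `|u i 0| <= `|u|.
Proof.
by rewrite [leRHS]/Num.norm /= mx_normrE (le_bigmax _ (fun ij => `|u ij.1 ij.2|) (i, 0)).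
Qed.

(** The crude constant [n.+1] replaces the square root of [n]; it is positive even for [n = 0], so
    that later radii can be divided by it. *)
Lemma enorm_le_norm n (u : 'cV[R]_n) : enorm u <= n.+1%:R * `|u|.
Proof.
rewrite -(@ler_pXn2r _ 2) ?nnegrE ?mulr_ge0 ?enorm_ge0 //.
rewrite sqr_enorm exprMn.
have : dotv u u <= \sum_(i < n) `|u| ^+ 2.
  apply: ler_sum => i _; rewrite -expr2 -[leLHS]ger0_norm ?sqr_ge0 //.
  by rewrite normrX ler_pXn2r ?nnegrE // coord_le_norm.
move=> /le_trans; apply; rewrite sumr_const card_ord -[leLHS]mulr_natl.
apply: ler_wpM2r; first exact: sqr_ge0.
by rewrite -natrX ler_nat expnS expn1 mulSn (leq_trans (leqnSn _)) ?leq_addr.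
Qed.

Lemma enorm_lip n (u v : 'cV[R]_n) : `|enorm u - enorm v| <= n.+1%:R * `|u - v|.
Proof.
apply: le_trans (enorm_le_norm _); rewrite ler_norml.
have := enormD (u - v) v; have := enormD (v - u) u; rewrite !subrK.
rewrite (enorm_distC v u); lra.
Qed.

Lemma continuousP_lt (V W : normedModType R) (f : V -> W) (x : V) :
  {for x, continuous f} <->
  forall e, 0 < e -> exists2 d, 0 < d & forall y, `|y - x| < d -> `|f y - f x| < e.
Proof.
split=> [/cvgrPdist_lt fc e /fc /nbhs_normP[d /= d0 h]|fc].
  by exists d => // y yx; rewrite distrC; apply: h; rewrite /ball_ /= distrC.
apply/cvgrPdist_lt => e /fc[d d0 h]; apply/nbhs_normP; exists d => //= y.
by rewrite /ball_ /= distrC => /h; rewrite distrC.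
Qed.

Lemma enorm_continuous n : continuous (@enorm n).
Proof.
move=> u; apply/(@continuousP_lt _ R^o) => e e0.
exists (e / n.+1%:R); first by rewrite divr_gt0.
move=> v uv; apply: le_lt_trans (enorm_lip _ _) _.
by rewrite mulrC -ltr_pdivlMr.
Qed.

Lemma dotv_lip n (v u w : 'cV[R]_n) :
  `|dotv v u - dotv v w| <= enorm v * enorm (u - w).
Proof.
rewrite ler_norml -dotvBr lerNl -dotvNr -{1}(enormN (u - w)).
by rewrite !dotv_le_enorm.
Qed.

Lemma dotv_continuous n (v : 'cV[R]_n) : continuous (dotv v).
Proof.
move=> u; apply/(@continuousP_lt _ R^o) => e e0.
have C0 : 0 < (enorm v + 1) * n.+1%:R by rewrite mulr_gt0 // ltr_wpDl ?enorm_ge0.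
exists (e / ((enorm v + 1) * n.+1%:R)); first by rewrite divr_gt0.
move=> w uw; apply: le_lt_trans (dotv_lip _ _ _) _.
move: uw; rewrite ltr_pdivlMr // mulrA => /(le_lt_trans _); apply.
have := enorm_le_norm (w - u); have := enorm_ge0 v; have := enorm_ge0 (w - u).
nra.
Qed.

(** Transposition identifies the ball with a set of row vectors that is a product of segments. *)
Lemma compact_cVball n (c : 'cV[R]_n) (r : R) :
  compact [set x : 'cV[R]_n | `|x - c| <= r].
Proof.
pose A := [set x : 'rV[R]_n | `|x^T - c| <= r].
have tr_cont : continuous (@trmx R 1 n).
  move=> M; apply/continuousP_lt => e e0; exists e => // N; apply: le_lt_trans.
  apply: norm_le_coord => // i; rewrite !mxE.
  rewrite [leRHS]/Num.norm /= mx_normrE.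
  have := le_bigmax 0 (fun ij => `|(N - M) ij.1 ij.2|) (0, i).
  by rewrite /= !mxE.
suff cA : compact A.
  have -> : [set x : 'cV[R]_n | `|x - c| <= r] = trmx @` A.
    apply/seteqP; split => [x xr|_ [x xA <-] //].
    by exists x^T; rewrite /A /= ?trmxK.
  by apply: continuous_compact cA; apply: continuous_subspaceT; exact: tr_cont.
have [r0|r0] := leP 0 r; last first.
  rewrite (_ : A = set0); first exact: compact0.
  by apply/seteqP; split => // x /le_lt_trans /(_ r0); rewrite normr_lt0.
rewrite (_ : A = [set v | forall i, `[c i 0 - r, c i 0 + r]%classic (v 0 i)]).
  apply: (@rV_compact R n (fun i => `[c i 0 - r, c i 0 + r]%classic)) => i.
  exact: segment_compact.
apply/seteqP; split => [x xr i|x xr].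
  by have := le_trans (coord_le_norm _ i) xr; rewrite !mxE ler_distl /= in_itv.
apply: norm_le_coord => // i; have := xr i.
by rewrite !mxE ler_distl /= in_itv.
Qed.

(* For a given displacement [u] one functional [v] serves all base points: this
   makes the condition linear in [f], so that averaging preserves it, which the
   mere inequality [a * enorm (q - p) <= enorm (f q - f p)] would not allow. *)
Definition expands n (f : 'cV[R]_n -> 'cV[R]_n) (a : R) (x : 'cV[R]_n) (d : R) :=
  forall u : 'cV[R]_n, exists2 v : 'cV[R]_n, enorm v <= 1 &
    forall p, `|p - x| < d -> `|p + u - x| < d ->
      a * enorm u <= dotv v (f (p + u) - f p).

(** * Local expansion from the regularity index *)

(** Take the supremum of the points [s] with [g s <= g 0]: by continuity it is such a point, and the
    local hypothesis would push it further if it were below [T]. Since that hypothesis may assume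
    [g s <= g 0], the lemma also serves as a connectedness argument for a nonnegative [g] vanishing
    at 0. *)
Lemma le_endpoints (g : R -> R) (T : R) : 0 <= T ->
  (forall s, 0 <= s <= T -> {for s, continuous g}) ->
  (forall s, 0 <= s < T -> g s <= g 0 ->
     exists2 t, 0 < t & forall r, s < r < s + t -> g r <= g s) ->
  g T <= g 0.
Proof.
move=> T0 gc h; pose S := [set s | 0 <= s <= T /\ g s <= g 0].
have supS : has_sup S.
  split; first by exists 0; split; rewrite ?lexx.
  by exists T => s [/andP[]].
have S0 : S 0 by split; rewrite ?lexx.
have sup_ge0 : 0 <= sup S by apply: ub_le_sup S0; case: supS.
have sup_leT : sup S <= T by apply: ge_sup; [exists 0|move=> s [/andP[]]].
have supP : g (sup S) <= g 0.
  rewrite leNgt; apply/negP => lt0.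
  have /(@continuousP_lt R^o R^o) : {for sup S, continuous g} by apply: gc; rewrite sup_ge0.
  move=> /(_ (g (sup S) - g 0)); rewrite subr_gt0 => /(_ lt0)[d d0 hd].
  have [s Ss ds] := sup_adherent d0 supS; have [_ gs] := Ss.
  have sS : s <= sup S by apply: ub_le_sup Ss; case: supS.
  have : `|s - sup S| < d by rewrite ltr_norml; lra.
  by move=> /hd; rewrite ltr_norml; lra.
have [<-//|ltT] : sup S = T \/ sup S < T by case: ltgtP sup_leT; auto.
have [||t t0 ht] := h (sup S) => //; first by rewrite sup_ge0.
pose r := Num.min T (sup S + t / 2).
have r1 : sup S < r by rewrite lt_min ltT ltrDl divr_gt0.
have r2 : r < sup S + t by rewrite gt_min; apply/orP; right; lra.
have : S r.
  split; first by rewrite ge_min lexx andbT (le_trans sup_ge0) ?ltW.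
  by apply: le_trans supP; apply: ht; rewrite r1.
by move/(ub_le_sup (proj2 supS)); rewrite leNgt r1.
Qed.

Lemma closure_norm (V : normedModType R) (C : set V) (p : V) :
  closure C p <-> forall e, 0 < e -> exists2 c, C c & `|c - p| < e.
Proof.
split=> [cl e e0|h B /nbhs_normP[e /= e0 eB]].
  have [|c [Cc pc]] := cl (ball_ Num.norm p e); first by apply/nbhs_normP; exists e.
  by exists c => //; rewrite distrC.
have [c Cc cp] := h e e0; exists c; split=> //.
by apply: eB; rewrite /ball_ /= distrC.
Qed.

(** The functional is the normalised point [c0] of least Euclidean norm in the closure of [C]:
    minimality along the segment from [c0] to [c] forces [0 <= dotv c0 (c - c0)]. *)
Lemma convex_separation n (C : set 'cV[R]_n) (a : R) :
  C !=set0 -> 0 < a -> (forall c, C c -> a <= enorm c) ->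
  (forall b c t, C b -> C c -> 0 <= t <= 1 -> C ((1 - t) *: b + t *: c)) ->
  exists2 v, enorm v = 1 & forall c, C c -> a <= dotv v c.
Proof.
move=> [c1 Cc1] a0 Ca Cconv.
(* Truncation gives compactness and loses no minimiser: outside this ball the Euclidean norm already
   exceeds that of [c1]. *)
pose K := closure C `&` [set x | `|x - 0| <= enorm c1].
have Kc : compact K.
  apply: subclosed_compact (@compact_cVball n 0 (enorm c1)) _; last by move=> x [].
  apply: closedI; first exact: closed_closure.
  exact: compact_closed (@compact_cVball n 0 _).
have [||c0] := @compact_EVT_min _ _ (@enorm n) K _ Kc.
- by exists c1; split; [exact: subset_closure|rewrite /= subr0 norm_le_enorm].
- exact/continuous_subspaceT/enorm_continuous.
rewrite inE => -[clc0 _] minK.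
have minC c : closure C c -> enorm c0 <= enorm c.
  move=> cc; have [cc1|cc1] := leP `|c| (enorm c1).
    by apply: minK; rewrite inE; split=> //=; rewrite subr0.
  apply: (@le_trans _ _ (enorm c1)); last exact: le_trans (ltW cc1) (norm_le_enorm _).
  by apply: minK; rewrite inE; split; [exact: subset_closure|rewrite /= subr0 norm_le_enorm].
have c0a : a <= enorm c0.
  apply/ler_addgt0Pr => e e0.
  have /closure_norm := clc0 => /(_ (e / n.+1%:R))[|c /Ca ac]; first by rewrite divr_gt0.
  rewrite ltr_pdivlMr // mulrC => /(le_lt_trans (enorm_lip _ _)).
  rewrite ltr_norml; lra.
have c0_gt0 : 0 < enorm c0 by apply: lt_le_trans c0a.
have key c : C c -> 0 <= dotv c0 (c - c0).
  move=> Cc; rewrite leNgt; apply/negP => D0.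
  set D := dotv c0 (c - c0) in D0 *; set E := dotv (c - c0) (c - c0).
  have E0 : 0 <= E by exact: dotvv_ge0.
  (* The squared norm changes by [2 * t * D + t ^+ 2 * E] along the segment; this [t] makes
     [t * E <= - D], so the change is at most [t * D < 0]. The denominator [E + 1] cannot vanish. *)
  pose t := Num.min 1 (- D / (E + 1)).
  have t0 : 0 < t by rewrite lt_min ltr01 divr_gt0 ?oppr_gt0 // ltr_wpDl.
  have t1 : t <= 1 by rewrite ge_min lexx.
  have tE : t * (E + 1) <= - D.
    by rewrite -ler_pdivlMr ?ltr_wpDl // ge_min lexx orbT.
  have : closure C (c0 + t *: (c - c0)).
    apply/closure_norm => e e0; have /closure_norm/(_ e e0)[b Cb bc0] := clc0.
    exists ((1 - t) *: b + t *: c); first by apply: Cconv => //; rewrite (ltW t0).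
    have -> : (1 - t) *: b + t *: c - (c0 + t *: (c - c0)) = (1 - t) *: (b - c0).
      by rewrite !scalerBr !scalerBl !scale1r; apply/colP => i; rewrite !mxE; ring.
    rewrite normrZ ger0_norm ?subr_ge0 //.
    apply: le_lt_trans bc0; rewrite ler_piMl //; lra.
  move/minC; rewrite -(@ler_pXn2r _ 2) ?nnegrE ?enorm_ge0 // !sqr_enorm.
  rewrite !(dotvDl, dotvDr) !(dotvZl, dotvZr) -/E (dotvC _ c0) -/D.
  nra.
exists ((enorm c0)^-1 *: c0).
  by rewrite enormZ ger0_norm ?invr_ge0 ?ltW // mulVf // gt_eqF.
move=> c /key; rewrite dotvBr subr_ge0 -sqr_enorm dotvZl => h.
rewrite mulrC ler_pdivlMr //; nra.
Qed.

(** The two families are concatenated, with weights scaled by [1 - t] and [t]. *)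
Lemma convex_hull_convex (V : lmodType R) (S : set V) (A B : V) (t : R) :
  convex_hull S A -> convex_hull S B -> 0 <= t <= 1 ->
  convex_hull S ((1 - t) *: A + t *: B).
Proof.
move=> [k [l [F [l0 l1 SF ->]]]] [k' [l' [F' [l'0 l'1 SF' ->]]]] /andP[t0 t1].
pose m (i : 'I_(k + k')) :=
  match fintype.split i with inl j => (1 - t) * l j | inr j => t * l' j end.
pose G (i : 'I_(k + k')) :=
  match fintype.split i with inl j => F j | inr j => F' j end.
exists (k + k')%N, m, G; split.
- by move=> i; rewrite /m; case: fintype.split => j; rewrite mulr_ge0 ?subr_ge0.
- rewrite big_split_ord /=.
  under eq_bigr do rewrite /m (unsplitK (inl _)).
  under [X in _ + X]eq_bigr do rewrite /m (unsplitK (inr _)).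
  by rewrite -!mulr_sumr l1 l'1 !mulr1 subrK.
- by move=> i; rewrite /G; case: fintype.split.
- rewrite big_split_ord /= !scaler_sumr; congr (_ + _); apply: eq_bigr => i _.
    by rewrite /m /G (unsplitK (inl _)) scalerA.
  by rewrite /m /G (unsplitK (inr _)) scalerA.
Qed.

Lemma sub_convex_hull (V : lmodType R) (S : set V) : S `<=` convex_hull S.
Proof.
move=> A SA; exists 1%N, (fun=> 1), (fun=> A); split=> //.
- by rewrite big_ord1.
- by rewrite big_ord1 scale1r.
Qed.

Lemma enorm_mulmx_le n (A : 'M[R]_n) (u : 'cV[R]_n) :
  enorm (A *m u) <= opnorm A * enorm u.
Proof.
(* The bound through the entries of [A] is what makes [sup] a genuine least upper bound rather than
   a default value. *)
have bnd : has_ubound [set enorm (A *m u) | u in [set u | enorm u <= 1]].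
  exists (n.+1%:R * \sum_i \sum_j `|A i j|) => _ [w /= w1 <-].
  apply: le_trans (enorm_le_norm _) _; apply: ler_wpM2l => //.
  have s0 i : 0 <= \sum_j `|A i j| by apply: sumr_ge0.
  apply: norm_le_coord => [|i]; first by apply: sumr_ge0.
  apply: (@le_trans _ _ (\sum_j `|A i j|)); last first.
    by rewrite [leRHS](bigD1 i) //= lerDl; apply: sumr_ge0.
  rewrite mxE; apply: le_trans (ler_norm_sum _ _ _) _.
  apply: ler_sum => j _; rewrite normrM ler_piMr //.
  exact: le_trans (coord_le_enorm _ _) w1.
have [->|u0] := eqVneq u 0; first by rewrite mulmx0 enorm0 mulr0.
rewrite -enorm_gt0 in u0.
rewrite -ler_pdivrMr // mulrC -[X in X * _]ger0_norm ?invr_ge0 ?enorm_ge0 //.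
rewrite -enormZ scalemxAr; apply: ub_le_sup => //; exists ((enorm u)^-1 *: u) => //=.
by rewrite enormZ ger0_norm ?invr_ge0 ?enorm_ge0 // mulVf ?gt_eqF.
Qed.

Lemma line_continuous n (p u : 'cV[R]_n) : continuous (fun s : R => p + s *: u).
Proof.
move=> s; apply/(@continuousP_lt R^o) => e e0.
have u0 : 0 < `|u| + 1 by rewrite ltr_wpDl.
exists (e / (`|u| + 1)) => [|r]; first by rewrite divr_gt0.
rewrite ltr_pdivlMr // => /(le_lt_trans _); apply.
rewrite opprD addrACA subrr add0r -scalerBl normrZ ler_wpM2l // lerDl //.
Qed.

Lemma limf_esup_lt_near (h : R -> R) (l : R) :
  (limf_esup (fun t => (h t)%:E) (0 : R)^'+ < l%:E)%E ->
  exists2 d, 0 < d & forall t, 0 < t < d -> h t < l.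
Proof.
rewrite /limf_esup => /ereal_inf_lt[_ [A A0 <-] supA].
have /nbhs_ballP[d /= d0 dA] := A0.
exists d => // t /andP[t0 td]; rewrite -lte_fin; apply: le_lt_trans supA.
apply: ereal_sup_ubound; exists t => //; apply: dA => //.
by rewrite /ball /= sub0r normrN gtr0_norm.
Qed.

Lemma regularity_index_le n (Jf : 'cV[R]_n -> set 'M[R]_n) (x w : 'cV[R]_n)
    (M : 'M[R]_n) (a : R) :
  (a%:E <= regularity_index Jf x)%E -> convex_hull (Jf x) M -> enorm w = 1 ->
  a <= enorm (M *m w).
Proof.
move=> ax JM w1; rewrite -lee_fin; apply: le_trans ax _.
apply: (@le_trans _ _ (conorm M)); first by apply: ereal_inf_lbound; exists M.
by apply: ereal_inf_lbound; exists w.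
Qed.

(** For the unit vector [w] along [u], the vectors [M *m w] with [M] in the hull of [Jf x] form a
    convex set at distance at least [b] from 0; the separating functional of this set is the
    required [v]. The margin [b - a] absorbs the variation of [Jf] near [x]. *)
Lemma expands_near n (f : 'cV[R]_n -> 'cV[R]_n) Jf (x : 'cV[R]_n) (a b : R) :
  continuous f -> pseudo_jacobian_map f Jf -> usc_at Jf x ->
  (b%:E <= regularity_index Jf x)%E -> 0 < b -> a < b ->
  exists2 d, 0 < d & expands f a x d.
Proof.
move=> fc Jpj Jusc bx b0 ab.
have [|delta delta0 Jdelta] := Jusc (b - a); first by rewrite subr_gt0.
exists (delta / n.+1%:R); first by rewrite divr_gt0.
move=> u; have [->|u0] := eqVneq u 0.
  by exists 0 => [|p _ _]; rewrite ?enorm0 // mulr0 -(scale0r 0) dotvZl mul0r.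
rewrite -enorm_gt0 in u0; set m := enorm u in u0 *.
pose w := m^-1 *: u.
have w1 : enorm w = 1.
  by rewrite enormZ ger0_norm ?invr_ge0 ?ltW // mulVf ?gt_eqF.
have uE : u = m *: w by rewrite scalerA divff ?scale1r ?gt_eqF.
pose C := [set M *m w | M in convex_hull (Jf x)].
have [|||v v1 vC] := @convex_separation n C b _ b0.
- have [[M JM] _ _] := Jpj x.
  by exists (M *m w), M => //; exact: sub_convex_hull.
- by move=> _ [M JM <-]; exact: regularity_index_le bx JM w1.
- move=> _ _ t [M JM <-] [N JN <-] t01; exists ((1 - t) *: M + t *: N).
    exact: convex_hull_convex.
  by rewrite mulmxDl !scalemxAl.
(* [M] lies within [b - a] of some [N] in [Jf x], and [dotv v (N *m w)] is at least [b]. *)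
have vJ q M : `|q - x| < delta / n.+1%:R -> Jf q M -> a * m <= dotv v (M *m u).
  move=> qx JM.
  have [|N JN MN] := Jdelta M.
    exists q => //; apply: le_lt_trans (enorm_le_norm _) _.
    by rewrite mulrC -ltr_pdivlMr.
  have := vC (N *m w) (ex_intro2 _ _ N (sub_convex_hull JN) erefl).
  have -> : M *m u = m *: (N *m w + (M - N) *m w).
    by rewrite -mulmxDl addrC subrK scalemxAr -uE.
  rewrite dotvZr dotvDr mulrC ler_pM2l // => hN.
  have := dotv_le_enorm (- v) ((M - N) *m w).
  have := enorm_mulmx_le (M - N) w.
  rewrite enormN v1 w1 mul1r mulr1 dotvNl; move: MN; rewrite /opball /=; lra.
exists v; first by rewrite v1.
move=> p px pux; apply/ler_addgt0Pr => e e0.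
(* The pseudo-Jacobian bounds upper derivatives, so a lower bound along [v] is obtained from [- v].
   The slack [e] turns the weak bound on the Dini derivative into a strict one, valid for all short
   difference quotients. *)
pose g (s : R) := dotv (- v) (f (p + s *: u)) + (a * m - e) * s.
suff : g 1 <= g 0.
  by rewrite /g scale1r scale0r addr0 mulr1 mulr0 addr0 !dotvNl dotvBr; lra.
apply: le_endpoints => //.
  have hc : continuous (fun s : R => dotv (- v) (f (p + s *: u))).
    move=> s; have := @dotv_continuous _ (- v) (f (p + s *: u)).
    have h1 := continuous_comp (@line_continuous n p u s) (fc (p + s *: u)).
    move=> h2; have h3 := continuous_comp h1 h2. exact: h3.
  by move=> s _; apply: (@cvgD R R^o); [exact: hc|exact: (@scaler_continuous R R^o)].
move=> s /andP[s0 s1] _; set q := p + s *: u.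
have qx : `|q - x| < delta / n.+1%:R.
  have -> : q - x = (1 - s) *: (p - x) + s *: (p + u - x).
    by apply/colP => i; rewrite !mxE; ring.
  apply: le_lt_trans (ler_normD _ _) _; rewrite !normrZ.
  rewrite (ger0_norm s0) ger0_norm; last lra.
  move: px pux; move: (delta / _) `|p - x| `|p + u - x| => D A B AD BD.
  have h1 : 0 < (1 - s) * (D - A) by rewrite mulr_gt0 // subr_gt0.
  have h2 : 0 <= s * (D - B) by rewrite mulr_ge0 // subr_ge0 ltW.
  nra.
have [_ _ /(_ u (- v)) dq] := Jpj q.
have [|t t0 hr] := @limf_esup_lt_near
    (fun t => (dotv (- v) (f (q + t *: u)) - dotv (- v) (f q)) / t)%R (- (a * m) + e)%R.
  apply: le_lt_trans dq _; apply: (@le_lt_trans _ _ (- (a * m))%:E); last first.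
    by rewrite lte_fin ltrDl.
  apply: ge_ereal_sup => _ [M JM <-].
  by rewrite lee_fin dotvNl lerN2; exact: vJ JM.
exists t => // r /andP[sr rt].
have ht : 0 < r - s < t by apply/andP; split; lra.
have := hr _ ht; have /andP[rs0 _] := ht; rewrite ltr_pdivrMr //.
have -> : q + (r - s) *: u = p + r *: u.
  by apply/colP => i; rewrite !mxE; ring.
rewrite /g -/q; lra.
Qed.

(** * Integral means over an interval *)

Local Notation RIntR := (@RInt.RInt Hierarchy.R_CompleteNormedModule).
Local Notation is_RIntR := (@RInt.is_RInt Hierarchy.R_NormedModule).
Local Notation ex_RIntR := (@RInt.ex_RInt Hierarchy.R_NormedModule).

Definition avg (h : R) (phi : R -> R) : R := ((RIntR phi 0%R h : R) / h)%R.

Lemma continuous_ex_RInt (phi : R -> R) (a b : R) :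
  continuous phi -> ex_RIntR phi a b.
Proof.
move=> pc; apply: (@RInt.ex_RInt_continuous Hierarchy.R_CompleteNormedModule) => z _.
by apply/Hierarchy.continuity_pt_filterlim/continuity_pt_cvg; exact: pc.
Qed.

Lemma RIntD (f g : R -> R) (a b : R) : ex_RIntR f a b -> ex_RIntR g a b ->
  RIntR (fun t => f t + g t)%R a b = (RIntR f a b : R) + (RIntR g a b : R) :> R.
Proof. exact: (@RInt.RInt_plus Hierarchy.R_CompleteNormedModule). Qed.

Lemma RIntZ (f : R -> R) (c a b : R) : ex_RIntR f a b ->
  RIntR (fun t => c * f t)%R a b = c * (RIntR f a b : R) :> R.
Proof. exact: (@RInt.RInt_scal Hierarchy.R_CompleteNormedModule). Qed.

Lemma RInt_cst (c a b : R) : RIntR (fun=> c) a b = (b - a) * c :> R.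
Proof. exact: (@RInt.RInt_const Hierarchy.R_CompleteNormedModule). Qed.

Lemma avgDZ (h c : R) (phi psi : R -> R) : continuous phi -> continuous psi ->
  avg h (fun t => phi t + c * psi t)%R = avg h phi + c * avg h psi.
Proof.
move=> pc qc; rewrite /avg mulrA -mulrDl; congr (_ / _).
rewrite RIntD ?RIntZ //; try exact: continuous_ex_RInt.
apply: (@RInt.ex_RInt_scal Hierarchy.R_NormedModule psi).
exact: continuous_ex_RInt.
Qed.

Lemma RInt_sub_le (phi : R -> R) (a b c e : R) : a <= b -> continuous phi ->
  (forall t, a <= t <= b -> `|phi t - c| <= e) ->
  `|(RIntR phi a b : R) - (b - a) * c| <= e * (b - a).
Proof.
move=> ab pc h; have pe := continuous_ex_RInt a b pc.
have ce r : ex_RIntR (fun=> r) a b by exact: (@RInt.ex_RInt_const Hierarchy.R_NormedModule).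
have -> : (RIntR phi a b : R) - (b - a) * c = RIntR (fun t => phi t + - c)%R a b.
  by rewrite RIntD // RInt_cst mulrN.
rewrite mulrC -RabsE; apply/RleP/RInt.abs_RInt_le_const; first exact/RleP.
  exact: (@RInt.ex_RInt_plus Hierarchy.R_NormedModule).
by move=> t [/RleP at1 /RleP tb]; apply/RleP; rewrite RabsE; apply: h; rewrite at1.
Qed.

Lemma avg_sub_le (h : R) (phi : R -> R) (c e : R) : 0 < h -> continuous phi ->
  (forall t, 0 <= t <= h -> `|phi t - c| <= e) -> `|avg h phi - c| <= e.
Proof.
move=> h0 pc /(@RInt_sub_le phi 0%R h c e (ltW h0) pc).
rewrite subr0 => le; have -> : avg h phi - c = ((RIntR phi 0%R h : R) - h * c) / h.
  by rewrite /avg mulrBl (mulrC h) mulfK ?gt_eqF.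
by rewrite normrM normfV (gtr0_norm h0) ler_pdivrMr.
Qed.

Lemma avg_ge (h : R) (phi : R -> R) (c : R) : 0 < h -> continuous phi ->
  (forall t, 0 <= t <= h -> c <= phi t) -> c <= avg h phi.
Proof.
move=> h0 pc le; rewrite /avg ler_pdivlMr // mulrC.
rewrite -[X in X * _]subr0 -RInt_cst.
apply/RleP/RInt.RInt_le; first exact/RleP/ltW.
- exact: (@RInt.ex_RInt_const Hierarchy.R_NormedModule).
- exact: continuous_ex_RInt.
- by move=> t [/RltP t0 /RltP th]; apply/RleP/le; rewrite !ltW.
Qed.

Lemma RIntC (phi : R -> R) (a b c : R) : continuous phi ->
  (RIntR phi a b : R) + (RIntR phi b c : R) = RIntR phi a c.
Proof.
move=> pc; apply: (@RInt.RInt_Chasles Hierarchy.R_CompleteNormedModule);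
exact: continuous_ex_RInt.
Qed.

Lemma RInt_small (phi : R -> R) (a s e : R) : continuous phi ->
  (forall t, `|t| <= `|s| -> `|phi (a + t)%R - phi a| <= e) ->
  `|(RIntR phi a (a + s)%R : R) - s * phi a| <= e * `|s|.
Proof.
move=> pc h; have [s0|s0] := leP 0 s.
  have := @RInt_sub_le phi a (a + s)%R (phi a) e.
  rewrite [a + s - a]addrC addKr (ger0_norm s0); apply => //; first by rewrite lerDl.
  move=> t /andP[t1 t2]; have := h (t - a)%R; rewrite (_ : (a + (t - a))%R = t); last ring.
  apply.
  by rewrite !ger0_norm //; lra.
have -> : (RIntR phi a (a + s)%R : R) = - (RIntR phi (a + s)%R a : R).
  by apply/eqP; rewrite -addr_eq0 RIntC // (@RInt.RInt_point Hierarchy.R_CompleteNormedModule).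
have := @RInt_sub_le phi (a + s)%R a (phi a) e.
rewrite (_ : a - (a + s) = - s); last by ring.
rewrite (ltr0_norm s0) -normrN opprD !mulNr opprK; apply => //; first lra.
move=> t /andP[t1 t2]; have := h (t - a)%R; rewrite (_ : (a + (t - a))%R = t); last ring.
  apply.
by rewrite (ltr0_norm s0) ler0_norm //; lra.
Qed.

(** Sliding the window from [[0, h]] to [[s, h + s]] only exchanges two end pieces of length [s], on
    which [phi] is nearly [phi h] and [phi 0]. Thus the mean has derivative [(phi h - phi 0) / h]
    with an explicit remainder. *)
Lemma avg_translate (h s : R) (phi : R -> R) (e : R) : 0 < h -> continuous phi ->
  (forall t, `|t| <= `|s| -> `|phi t - phi 0| <= e) ->
  (forall t, `|t| <= `|s| -> `|phi (h + t)%R - phi h| <= e) ->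
  `|avg h (fun t => phi (t + s)%R) - avg h phi - s * (h^-1 * (phi h - phi 0))|
     <= 2 * e / h * `|s|.
Proof.
move=> h0 pc p0 ph.
have shift : (RIntR (fun t => phi (t + s)%R) 0%R h : R) = RIntR phi s (h + s)%R.
  have := @RInt.RInt_comp_lin Hierarchy.R_CompleteNormedModule phi 1%R s 0%R h.
  rewrite !(RmultE, RplusE) !mul1r add0r => <-; last exact: continuous_ex_RInt.
  apply: (@RInt.RInt_ext Hierarchy.R_CompleteNormedModule) => t _.
  by rewrite !(RmultE, RplusE) /Hierarchy.scal /= /Hierarchy.mult /= RmultE !mul1r.
have r1 := RInt_small pc ph.
have r0 : `|(RIntR phi 0%R s : R) - s * phi 0| <= e * `|s|.
  by rewrite -{1}[s]add0r; apply: RInt_small => // t /p0; rewrite add0r.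
rewrite /avg shift.
(* Both identities compute the integral from 0 to [h + s], once through [s] and once through [h]. *)
have c1 := RIntC 0%R s (h + s)%R pc; have c2 := RIntC 0%R h (h + s)%R pc.
set A := (RIntR phi s _ : R) in c1 *; set B := (RIntR phi 0%R h : R) in c2 *.
set X := (RIntR phi h _ : R) in c2 r1; set Y := (RIntR phi 0%R s : R) in c1 r0.
have -> : A / h - B / h - s * (h^-1 * (phi h - phi 0)) =
    ((X - s * phi h) - (Y - s * phi 0)) / h.
  have -> : A = B + X - Y by rewrite c2 -c1; ring.
  by field; rewrite gt_eqF.
rewrite normrM normfV (gtr0_norm h0) mulrAC ler_pM2r ?invr_gt0 //.
apply: le_trans (ler_normB _ _) _; lra.
Qed.

(** * Steklov averages and smoothing *)

(** The conclusion is a weak inequality because weak inequalities pass through averages with the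
    same [d]. *)
Definition ucont n (F : 'cV[R]_n -> 'cV[R]_n) :=
  forall e, 0 < e -> exists2 d, 0 < d &
    forall p q, `|p - q| < d -> `|F p - F q| <= e.

Definition axis n (i : 'I_n) : 'cV[R]_n := delta_mx i 0.

(** [G] is the partial derivative along axis [i], with a remainder uniform in [p]: the uniformity
    lets the estimate be averaged over translates. *)
Definition udiff n (F : 'cV[R]_n -> 'cV[R]_n) (i : 'I_n) G :=
  ucont G /\ forall e, 0 < e -> exists2 d, 0 < d &
    forall p s, `|s| < d ->
      `|F (p + s *: axis i) - F p - s *: G p| <= e * `|s|.

(** The average runs along one axis only; iterating over all axes gives an average over a box. *)
Definition steklov n (h : R) (i : 'I_n) (F : 'cV[R]_n -> 'cV[R]_n) p : 'cV[R]_n :=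
  \col_k avg h (fun t => F (p + t *: axis i) k 0).

Lemma axis_norm n (i : 'I_n) (t : R) : `|t *: axis i| <= `|t|.
Proof.
apply: norm_le_coord => // j; rewrite !mxE andbT.
by case: eqP; rewrite ?mulr1 // mulr0 normr0.
Qed.

Lemma ucont_continuous n (F : 'cV[R]_n -> 'cV[R]_n) : ucont F -> continuous F.
Proof.
move=> Fu p; apply/continuousP_lt => e e0.
have [|d d0 h] := Fu (e / 2); first by rewrite divr_gt0.
by exists d => // q /h /le_lt_trans; apply; lra.
Qed.

Lemma ucont_line n (F : 'cV[R]_n -> 'cV[R]_n) (p u : 'cV[R]_n) (k : 'I_n) :
  ucont F -> continuous (fun t : R => F (p + t *: u) k 0).
Proof.
move=> /ucont_continuous Fc t.
have h1 := continuous_comp (@line_continuous n p u t) (Fc (p + t *: u)).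
have h2 := continuous_comp h1 (@coord_continuous _ _ _ k 0 _).
exact: h2.
Qed.

Lemma ucont_translate n (F : 'cV[R]_n -> 'cV[R]_n) (u : 'cV[R]_n) :
  ucont F -> ucont (fun p => F (p + u)).
Proof.
move=> Fu e /Fu[d d0 h]; exists d => // p q pq; apply: h.
by rewrite opprD addrACA subrr addr0.
Qed.

Lemma ucontDZ n (F G : 'cV[R]_n -> 'cV[R]_n) (c : R) :
  ucont F -> ucont G -> ucont (fun p => F p + c *: G p).
Proof.
move=> Fu Gu e e0.
have [|d d0 hF] := Fu (e / 2); first by rewrite divr_gt0.
have c0 : 0 < `|c| + 1 by rewrite ltr_wpDl.
have [|d' d'0 hG] := Gu (e / 2 / (`|c| + 1)); first by rewrite !divr_gt0.
exists (Num.min d d') => [|p q]; first by rewrite lt_min d0.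
rewrite lt_min => /andP[/hF {}hF /hG {}hG].
rewrite opprD addrACA -scalerBr.
apply: le_trans (ler_normD _ _) _; rewrite normrZ.
move: hG; rewrite ler_pdivlMr // => hG.
have := normr_ge0 (G p - G q); nra.
Qed.

Section steklov_average.
Variables (n : nat) (h : R) (i : 'I_n).
Hypothesis h0 : 0 < h.
Implicit Types F G : 'cV[R]_n -> 'cV[R]_n.

Lemma steklovDZ F G (c : R) p : ucont F -> ucont G ->
  steklov h i (fun q => F q + c *: G q) p = steklov h i F p + c *: steklov h i G p.
Proof.
move=> Fu Gu; apply/colP => k; rewrite !mxE.
rewrite -avgDZ; [|exact: ucont_line|exact: ucont_line].
by congr avg; apply/funext => t; rewrite !mxE.
Qed.

Lemma steklovB F G p : ucont F -> ucont G ->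
  steklov h i (fun q => F q - G q) p = steklov h i F p - steklov h i G p.
Proof.
move=> Fu Gu; rewrite -scaleN1r -steklovDZ //.
by congr (steklov _ _ _ _); apply/funext => q; rewrite scaleN1r.
Qed.

Lemma steklov_le F p c e : ucont F -> 
  (forall t, 0 <= t <= h -> `|F (p + t *: axis i) - c| <= e) ->
  `|steklov h i F p - c| <= e.
Proof.
move=> Fu le; have e0 : 0 <= e.
  by have := le 0; rewrite lexx ltW // => /(_ isT); exact: le_trans.
apply: norm_le_coord => // k; rewrite !mxE.
apply: avg_sub_le => // [|t /le]; first exact: ucont_line.
by move/(le_trans (coord_le_norm _ k)); rewrite !mxE.
Qed.

Lemma dotv_steklov F v p : ucont F ->
  dotv v (steklov h i F p) = avg h (fun t => dotv v (F (p + t *: axis i))).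
Proof.
move=> Fu; rewrite /dotv.
(* Continuity of the partial sums is carried through the induction, since additivity of [avg]
   requires it. *)
have [H _] : avg h (fun t => \sum_(k <- index_enum 'I_n) v k 0 * F (p + t *: axis i) k 0) =
     \sum_(k <- index_enum 'I_n) v k 0 * steklov h i F p k 0
   /\ continuous (fun t : R => \sum_(k <- index_enum 'I_n) v k 0 * F (p + t *: axis i) k 0).
  elim: (index_enum _) => [|k s [IH IHc]].
    under [X in avg h X]funext do rewrite big_nil.
    under [X in continuous X]funext do rewrite big_nil.
    split. by rewrite big_nil /avg RInt_cst mulr0 mul0r.
    exact: cst_continuous.
  under [X in avg h X]funext do rewrite big_cons addrC.
  under [X in continuous X]funext do rewrite big_cons addrC.
  have Fk : continuous (fun t : R => F (p + t *: axis i) k 0) by exact: ucont_line.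
  split; first by rewrite avgDZ // IH big_cons addrC !mxE.
  move=> t; apply: (@cvgD R R^o); first exact: IHc.
  by apply: (@cvgZl_tmp R R^o); exact: Fk.
by rewrite -H.
Qed.

Lemma ucont_steklov F : ucont F -> ucont (steklov h i F).
Proof.
move=> Fu e e0; have [d d0 hF] := Fu _ e0; exists d => // p q pq.
have -> : steklov h i F q = steklov h i (fun p' => F (p' + (q - p))) p.
  apply/colP => k; rewrite !mxE; congr avg; apply/funext => t.
  by congr (F _ k 0); apply/colP => j; rewrite !mxE; ring.
rewrite -steklovB //; last exact: ucont_translate.
rewrite -[X in `|X|]subr0; apply: steklov_le.
  have := @ucontDZ n F (fun p' => F (p' + (q - p))) (-1)%R Fu (ucont_translate _ Fu).
  by under [X in ucont X]funext do rewrite scaleN1r.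
move=> t _; rewrite subr0; apply: hF.
by rewrite opprD addrA subrr add0r opprB.
Qed.

Lemma steklov_close F e d : ucont F -> h < d ->
  (forall p q, `|p - q| < d -> `|F p - F q| <= e) ->
  forall p, `|steklov h i F p - F p| <= e.
Proof.
move=> Fu hd Fe p; apply: steklov_le => // t /andP[t0 th].
apply: Fe; rewrite addrC addKr; apply: le_lt_trans (axis_norm _ _) _.
by rewrite ger0_norm // (le_lt_trans th).
Qed.

(** The remainder estimate holds at every translate of [p], hence for the average. So a later
    average keeps the partial derivatives created by earlier ones. *)
Lemma udiff_steklov F j G : ucont F -> udiff F j G ->
  udiff (steklov h i F) j (steklov h i G).
Proof.
move=> Fu [Gu FG]; split; first exact: ucont_steklov.
move=> e /FG[d d0 le]; exists d => // p s sd.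
have Fs : ucont (fun q => F (q + s *: axis j)) by exact: ucont_translate.
have -> : steklov h i F (p + s *: axis j) =
    steklov h i (fun q => F (q + s *: axis j)) p.
  apply/colP => k; rewrite !mxE; congr avg; apply/funext => t.
  by rewrite addrAC.
have FF : ucont (fun q => F (q + s *: axis j) - F q).
  have := ucontDZ (-1)%R Fs Fu.
  by under [X in ucont X]funext do rewrite scaleN1r.
rewrite -steklovB // -scaleNr -steklovDZ //.
rewrite -[X in `|X|]subr0; apply: steklov_le => [|t _]; first exact: ucontDZ.
by rewrite subr0 scaleNr; exact: le.
Qed.

Lemma udiff_steklov_axis F : ucont F ->
  udiff (steklov h i F) i (fun p => h^-1 *: (F (p + h *: axis i) - F p)).
Proof.
move=> Fu; split.
  move=> e e0; have [|d d0 le] := Fu (e * h / 2); first by rewrite divr_gt0 ?mulr_gt0.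
  exists d => // p q pq; rewrite -scalerBr normrZ gtr0_norm ?invr_gt0 //.
  rewrite mulrC ler_pdivrMr // opprB addrACA [X in _ + X]addrC.
  rewrite [X in `|X|](_ : _ = (F (p + h *: axis i) - F (q + h *: axis i)) - (F p - F q)).
    apply: le_trans (ler_normB _ _) _; have := le _ _ pq.
    have := le (p + h *: axis i) (q + h *: axis i).
    by rewrite opprD addrACA subrr addr0 => /(_ pq); lra.
  by apply/colP => k; rewrite !mxE; ring.
move=> e e0; have [|d d0 le] := Fu (e * h / 2); first by rewrite divr_gt0 ?mulr_gt0.
exists d => // p s sd; apply: norm_le_coord => [|k]; first by rewrite mulr_ge0 // ltW.
rewrite !mxE.
pose phi t := F (p + t *: axis i) k 0.
have pc : continuous phi by exact: ucont_line.
have near t r : `|r| <= `|s| -> `|phi (t + r)%R - phi t| <= e * h / 2.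
  move=> rs; have := le (p + (t + r) *: axis i) (p + t *: axis i).
  rewrite scalerDl opprD addrACA subrr add0r addrAC subrr add0r.
  move=> /(_ (le_lt_trans (le_trans (axis_norm _ _) rs) sd)).
  move=> /(le_trans (coord_le_norm _ k)); rewrite !mxE /phi.
  by rewrite scalerDl.
have near0 t : `|t| <= `|s| -> `|phi t - phi 0| <= e * h / 2.
  by move=> /(near 0); rewrite add0r.
have := avg_translate h0 pc near0 (near h).
have -> : 2 * (e * h / 2) / h = e by field; rewrite gt_eqF.
have -> : phi 0 = F p k 0 by rewrite /phi scale0r addr0.
have -> : (fun t => phi (t + s)%R) = (fun t => F (p + s *: axis i + t *: axis i) k 0).
  by apply/funext => t; rewrite /phi scalerDl addrA addrAC.
by [].
Qed.

(** The same [v] serves all the translates, so the inequality can be averaged; translates move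
    points by at most [h], whence the loss in the radius. *)
Lemma expands_steklov F a x d : ucont F -> expands F a x d ->
  expands (steklov h i F) a x (d - h)%R.
Proof.
move=> Fu Fexp u; have [v v1 vF] := Fexp u; exists v => // p px pux.
have Fus := ucont_translate u Fu.
have -> : steklov h i F (p + u) = steklov h i (fun q => F (q + u)) p.
  apply/colP => k; rewrite !mxE; congr avg; apply/funext => t.
  by rewrite addrAC.
have Gu : ucont (fun q => F (q + u) - F q).
  have := ucontDZ (-1)%R Fus Fu.
  by under [X in ucont X]funext do rewrite scaleN1r.
rewrite -steklovB // dotv_steklov //; apply: avg_ge => //.
  move=> t; have Gc := ucont_continuous Gu.
  have h1 := continuous_comp (@line_continuous n p (axis i) t) (Gc _).
  have h2 := continuous_comp h1 (@dotv_continuous _ v _).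
  exact: h2.
move=> t /andP[t0 th]; have ta : `|t *: axis i| <= h.
  by apply: le_trans (axis_norm _ _) _; rewrite ger0_norm.
apply: vF; first rewrite addrAC.
  apply: le_lt_trans (ler_normD _ _) _; lra.
rewrite (_ : _ - x = (p + u - x) + t *: axis i).
  apply: le_lt_trans (ler_normD _ _) _; lra.
by apply/colP => k; rewrite !mxE; ring.
Qed.

End steklov_average.

(** One average per axis in [s]. Half of the tolerance [e] goes to the axes already treated, half to
    the new one, whose width [h] also bounds the loss of radius. *)
Lemma smoothing n (s : seq 'I_n) F a x d e : ucont F -> expands F a x d ->
  0 < e -> exists F', [/\ ucont F', forall p, `|F' p - F p| <= e,
    expands F' a x (d - e)%R & forall i, i \in s -> exists G, udiff F' i G].
Proof.
move=> Fu Fexp; elim: s e => [|i s IH] e e0.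
  exists F; split => // [p|u]; first by rewrite subrr normr0 ltW.
  have [v v1 vF] := Fexp u; exists v => // p pu pux.
  by apply: vF; lra.
have [|F1 [F1u F1F F1exp F1d]] := IH (e / 2); first by rewrite divr_gt0.
have [|c c0 F1c] := F1u (e / 2); first by rewrite divr_gt0.
pose h := Num.min (c / 2) (e / 2).
have h0 : 0 < h by rewrite lt_min !divr_gt0.
have hc : h < c by rewrite /h gt_min; apply/orP; left; lra.
have he : h <= e / 2 by rewrite /h ge_min lexx orbT.
exists (steklov h i F1); split.
- exact: ucont_steklov.
- move=> p; have := steklov_close i h0 F1u hc F1c p; have := F1F p.
  rewrite -[X in _ -> _ -> `|X| <= _](subrKA (F1 p)) => h1 h2.
  apply: le_trans (ler_normD _ _) _; lra.
- move=> u; have [v v1 vF] := expands_steklov i h0 F1u F1exp u.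
  by exists v => // p pu pux; apply: vF; lra.
- move=> j; rewrite inE => /orP[/eqP->|/F1d[G FG]].
    by eexists; exact: udiff_steklov_axis.
  by eexists; apply: udiff_steklov FG.
Qed.

(** * Local surjectivity of expanding maps *)

Lemma expands_le n (f : 'cV[R]_n -> 'cV[R]_n) a x d p q : expands f a x d ->
  `|p - x| < d -> `|q - x| < d -> a * enorm (q - p) <= enorm (f q - f p).
Proof.
move=> fexp px qx; have [v v1 /(_ p px)] := fexp (q - p).
rewrite (addrC p) subrK => /(_ qx) /le_trans; apply.
apply: le_trans (dotv_le_enorm _ _) _.
by rewrite ler_piMl // enorm_ge0.
Qed.

(** The displacement is performed one axis at a time, by induction on the list of axes. A third of
    [e] is allotted to each of three errors: the partial derivative at the displaced point, the
    variation of [G i] between that point and [z], and the previous axes. *)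
Lemma udiff_line n (F : 'cV[R]_n -> 'cV[R]_n) (G : 'I_n -> 'cV[R]_n -> 'cV[R]_n) :
  (forall i, udiff F i (G i)) -> forall (z u : 'cV[R]_n) e, 0 < e ->
  exists2 d, 0 < d & forall t, 0 < t < d ->
    `|F (z + t *: u) - F z - t *: \sum_i u i 0 *: G i z| <= e * t.
Proof.
move=> FG z u.
suff H (s : seq 'I_n) e : 0 < e -> exists2 d, 0 < d & forall t, 0 < t < d ->
    `|F (z + t *: \sum_(i <- s) u i 0 *: axis i) - F z
       - t *: \sum_(i <- s) u i 0 *: G i z| <= e * t.
  move=> e /(H (index_enum 'I_n))[d d0 h]; exists d => // t /h.
  suff -> : \sum_(i <- index_enum 'I_n) u i 0 *: axis i = u by [].
  apply/colP => k; rewrite summxE (bigD1 k) //= big1 => [|j jk].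
    by rewrite !mxE !eqxx mulr1 addr0.
  by rewrite !mxE eq_sym (negbTE jk) mulr0.
elim: s e => [|i s IH] e e0.
  exists 1 => // t /andP[t0 _].
  by rewrite !big_nil !scaler0 addr0 !subrr normr0 mulr_ge0 // ltW.
have e3 : 0 < e / 3 by rewrite divr_gt0.
have [d d0 h] := IH _ e3.
have [Gu Fd] := FG i; set c := u i 0.
have c0 : 0 < `|c| + 1 by rewrite ltr_wpDl.
have e3c : 0 < e / 3 / (`|c| + 1) by rewrite divr_gt0.
have [d1 d10 h1] := Fd _ e3c.
have [d2 d20 h2] := Gu _ e3c.
set S := \sum_(j <- s) u j 0 *: axis j in h.
have S0 : 0 < `|S| + 1 by rewrite ltr_wpDl.
exists (Num.min d (Num.min (d1 / (`|c| + 1)) (d2 / (`|S| + 1)))).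
  by rewrite !lt_min d0 !divr_gt0.
move=> t /andP[t0]; rewrite !lt_min => /and3P[td].
rewrite !ltr_pdivlMr // => td1 td2.
rewrite !big_cons -/c -/S; set T := \sum_(j <- s) _ in h *.
have {h} hS := h t; rewrite t0 td in hS; have {}hS := hS isT.
have := h1 (z + t *: S) (t * c)%R; rewrite normrM (gtr0_norm t0).
have tc : t * `|c| < d1 by apply: le_lt_trans td1; rewrite ler_pM2l // lerDl.
move=> /(_ tc) {}h1.
have := h2 (z + t *: S) z; rewrite addrC addKr normrZ (gtr0_norm t0).
have tS : t * `|S| < d2 by apply: le_lt_trans td2; rewrite ler_pM2l // lerDl.
move=> /(_ tS) {}h2.
rewrite (_ : _ - _ = (F (z + t *: S + (t * c) *: axis i) - F (z + t *: S)
      - (t * c) *: G i (z + t *: S))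
   + (t * c) *: (G i (z + t *: S) - G i z) + (F (z + t *: S) - F z - t *: T)); last first.
  have -> : z + t *: (c *: axis i + S) = z + t *: S + (t * c) *: axis i.
    by apply/colP => k; rewrite !mxE; ring.
  by apply/colP => k; rewrite !mxE; ring.
apply: le_trans (ler_normD _ _) _.
have hc x : x <= e / 3 / (`|c| + 1) -> t * `|c| * x <= e / 3 * t.
  rewrite ler_pdivlMr // => hx; rewrite -mulrA mulrC ler_pM2r // mulrC.
  by have [x0|x0] := leP 0 x; have := normr_ge0 c; nra.
have : `|(t * c) *: (G i (z + t *: S) - G i z)| <= e / 3 * t.
  by rewrite normrZ normrM (gtr0_norm t0); exact: hc.
have : `|F (z + t *: S + (t * c) *: axis i) - F (z + t *: S)
      - (t * c) *: G i (z + t *: S)| <= e / 3 * t.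
  by apply: le_trans h1 _; rewrite mulrC; exact: hc.
have := ler_normD (F (z + t *: S + (t * c) *: axis i) - F (z + t *: S)
      - (t * c) *: G i (z + t *: S)) ((t * c) *: (G i (z + t *: S) - G i z)).
have -> : e * t = e / 3 * t + e / 3 * t + e / 3 * t by field.
lra.
Qed.

(** Half the squared distance from [F] to [y] has derivative [D] along axis [i] at [z]; if [D] were
    nonzero, a short move against its sign would decrease the distance. *)
Lemma critical_point n (F : 'cV[R]_n -> 'cV[R]_n) (i : 'I_n) G (y z : 'cV[R]_n) r :
  udiff F i G -> 0 < r ->
  (forall q, `|q - z| < r -> enorm (F z - y) <= enorm (F q - y)) ->
  dotv (F z - y) (G z) = 0.
Proof.
move=> [_ FG] r0 zmin; set w := F z - y; set D := dotv w (G z).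
apply/eqP; rewrite -normr_eq0 -[_ == _]negbK -normr_gt0 normr_id; apply/negP => D0.
pose C : R := n.+1%:R; have C0 : 0 < C by [].
pose A := enorm w * C; have A0 : 0 <= A by rewrite mulr_ge0 ?enorm_ge0.
(* The remainder then contributes at most half of the first-order decrease [t * |D|]. *)
pose e1 := `|D| / (2 * (A + 1)).
have A1 : 0 < A + 1 by rewrite ltr_wpDl.
have e10 : 0 < e1 by rewrite divr_gt0 // mulr_gt0.
have e1A : 2 * (A * e1) <= `|D|.
  have : e1 * (2 * (A + 1)) = `|D| by rewrite divfK // gt_eqF // mulr_gt0.
  nra.
have [d d0 h] := FG _ e10.
pose B := C * (`|G z| + e1); have B0 : 0 < B by rewrite mulr_gt0 // ltr_wpDl.
(* [t] lies within both radii and makes the quadratic term [(B * t) ^+ 2] smaller than [t * |D|]. *)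
pose t := Num.min (Num.min d r) (`|D| / B ^+ 2) / 2.
have m0 : 0 < Num.min (Num.min d r) (`|D| / B ^+ 2).
  by rewrite !lt_min d0 r0 divr_gt0 // exprn_gt0.
have t0 : 0 < t by rewrite divr_gt0.
have tm : t < Num.min (Num.min d r) (`|D| / B ^+ 2) by rewrite /t; lra.
move: tm; rewrite !lt_min => /andP[/andP[td tr]].
rewrite ltr_pdivlMr ?exprn_gt0 // => tB.
pose s := - (Num.sg D * t).
have sn : `|s| = t.
  by rewrite normrN normrM (gtr0_norm t0) normr_sg -normr_gt0 D0 mul1r.
have sD : s * D = - (t * `|D|) by rewrite normrEsg /s; ring.
set De := F (z + s *: axis i) - F z.
have hD : `|De - s *: G z| <= e1 * t by rewrite -sn; apply: h; rewrite sn.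
have h1 : dotv w De <= - (t * `|D|) + A * e1 * t.
  rewrite -(subrK (s *: G z) De) dotvDr dotvZr -/D sD addrC lerD2l.
  apply: le_trans (dotv_le_enorm _ _) _.
  rewrite -mulrA /A -mulrA ler_wpM2l ?enorm_ge0 //.
  by apply: le_trans (enorm_le_norm _) _; rewrite ler_pM2l.
have h2 : enorm De <= B * t.
  apply: le_trans (enorm_le_norm _) _; rewrite -mulrA ler_pM2l //.
  rewrite -(subrK (s *: G z) De); apply: le_trans (ler_normD _ _) _.
  by rewrite normrZ sn; lra.
have : enorm w <= enorm (w + De).
  have -> : w + De = F (z + s *: axis i) - y.
    by apply/colP => k; rewrite !mxE; ring.
  apply: zmin; rewrite addrC addKr.
  by apply: le_lt_trans (axis_norm _ _) _; rewrite sn.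
rewrite -(@ler_pXn2r _ 2) ?nnegrE ?enorm_ge0 // !sqr_enorm.
rewrite dotv_sqrD -(sqr_enorm De).
have h3 : enorm De ^+ 2 <= (B * t) ^+ 2.
  by rewrite ler_pXn2r ?nnegrE ?enorm_ge0 // mulr_ge0 // ltW.
have h4 : t * (t * B ^+ 2) < t * `|D| by rewrite ltr_pM2l.
have h5 : t * (2 * (A * e1)) <= t * `|D| by rewrite ler_pM2l.
rewrite exprMn in h3; nra.
Qed.

(** A minimiser [z] of the distance to [y] over the closed ball of radius [r] is interior, hence
    critical. A nonzero residual there would make the derivative singular, and [F] would move too
    little along a kernel direction to be expanding. *)
Lemma smooth_surjective n (F : 'cV[R]_n -> 'cV[R]_n) a (x y : 'cV[R]_n) r d :
  ucont F -> (forall i, exists G, udiff F i G) -> expands F a x d ->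
  0 < a -> 0 < r < d -> 2 * enorm (y - F x) < a * r ->
  exists2 z, `|z - x| <= r & F z = y.
Proof.
move=> Fu FG Fexp a0 /andP[r0 rd] ya.
have [G {}FG] := choice FG.
have := @compact_EVT_min _ _ (fun q => enorm (F q - y)) _ _ (@compact_cVball n x r).
case.
- by exists x; rewrite /= subrr normr0 ltW.
- apply: continuous_subspaceT => q.
  have Fy : ucont (fun q => F q - y).
    move=> e /Fu[c c0 h]; exists c => // p p' /h.
    by rewrite opprB addrA subrK.
  have h1 := ucont_continuous Fy; have {}h1 := h1 q.
  have h2 := continuous_comp h1 (@enorm_continuous _ _).
  exact: h2.
move=> z; rewrite inE /= => zr zmin; exists z => //.
have {}zmin q : `|q - x| <= r -> enorm (F z - y) <= enorm (F q - y).
  by move=> qr; apply: zmin; rewrite inE.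
have zlt : `|z - x| < r.
  (* On the boundary, expansion gives [a * r] as a lower bound for the distance from [F x] to [F z],
     while minimality bounds it by [2 * enorm (y - F x)]. *)
  rewrite lt_neqAle zr andbT; apply/eqP => zr'.
  have d0 : 0 < d by apply: lt_trans rd.
  have xx : `|x - x| < d by rewrite subrr normr0.
  have := expands_le Fexp xx (le_lt_trans zr rd).
  have := enorm_distD y (F z) (F x); have := zmin x; rewrite subrr normr0 ltW // => /(_ isT).
  have : a * r <= a * enorm (z - x) by rewrite ler_pM2l // -zr' norm_le_enorm.
  rewrite (enorm_distC (F x) y); lra.
have crit i : dotv (F z - y) (G i z) = 0.
  apply: (critical_point (FG i)) (_ : 0 < r - `|z - x|) _; first by rewrite subr_gt0.
  move=> q qz; apply: zmin; rewrite -(subrKA z).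
  apply: le_trans (ler_normD _ _) _; lra.
apply/eqP; rewrite -subr_eq0; apply/negPn/negP => w0.
(* The residual is a left null vector of the Jacobian matrix [M]; the vanishing determinant converts
   it into a right null vector. *)
pose M : 'M[R]_n := \matrix_(k, i) G i z k 0.
have detM : \det M = 0.
  apply/eqP/det0P; exists (F z - y)^T; first by rewrite trmx_eq0.
  apply/rowP => i; rewrite !mxE -[RHS](crit i).
  by apply: eq_bigr => k _; rewrite !mxE.
have [v v0 vM] : exists2 v : 'rV_n, v != 0 & v *m M^T = 0.
  by apply/det0P; rewrite det_tr detM.
have u0 : 0 < enorm v^T by rewrite enorm_gt0 trmx_eq0.
have Mu : \sum_i v^T i 0 *: G i z = 0.
  apply/colP => k; transitivity ((v *m M^T) 0 k); last by rewrite vM !mxE.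
  by rewrite summxE mxE; apply: eq_bigr => i _; rewrite !mxE.
(* With this [e], the displacement of [F] along [t *: v^T] is at most half of what expansion
   demands. *)
pose e := a * enorm v^T / n.+1%:R / 2.
have e0 : 0 < e by rewrite !divr_gt0 ?mulr_gt0.
have [c c0 h] := udiff_line FG z v^T e0.
have v1 : 0 < `|v^T| + 1 by rewrite ltr_wpDl.
pose t := Num.min c ((r - `|z - x|) / (`|v^T| + 1)) / 2.
have m0 : 0 < Num.min c ((r - `|z - x|) / (`|v^T| + 1)).
  by rewrite lt_min c0 divr_gt0 // subr_gt0.
have t0 : 0 < t by rewrite divr_gt0.
have : t < Num.min c ((r - `|z - x|) / (`|v^T| + 1)) by rewrite /t; lra.
rewrite lt_min ltr_pdivlMr // => /andP[tc tr].
have := h t; rewrite t0 tc Mu scaler0 subr0 => /(_ isT) {}h.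
have zd : `|z - x| < d by apply: lt_trans rd.
have qd : `|z + t *: v^T - x| < d.
  rewrite addrAC; apply: le_lt_trans (ler_normD _ _) _; rewrite normrZ gtr0_norm //.
  lra.
have := expands_le Fexp zd qd; rewrite addrC addKr enormZ gtr0_norm //.
apply/negP; rewrite -ltNge; apply: le_lt_trans (enorm_le_norm _) _.
apply: (@le_lt_trans _ _ (n.+1%:R * (e * t))); first by rewrite ler_pM2l.
have -> : n.+1%:R * (e * t) = a * (t * enorm v^T) / 2.
  have : n.+1%:R != 0 :> R by rewrite pnatr_eq0.
  by rewrite /e; move: n.+1%:R => C C0; field.
have : 0 < a * (t * enorm v^T) by rewrite !mulr_gt0.
lra.
Qed.

Lemma ucont_compact n (f : 'cV[R]_n -> 'cV[R]_n) (x : 'cV[R]_n) (r e : R) :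
  continuous f -> 0 < e -> exists2 d, 0 < d &
    forall p q, `|p - x| <= r -> `|p - q| < d -> `|f p - f q| <= e.
Proof.
move=> fc e0.
have /compact_near_coveringP cov := @compact_cVball n x r.
pose P (d : R) p := 0 < d /\ forall q, `|p - q| < d -> `|f p - f q| <= e.
have A : \forall d \near (@GRing.zero R)^'+, [set p | `|p - x| <= r] `<=` P d.
  apply: cov => p _.
  have e2 : 0 < e / 2 by rewrite divr_gt0.
  have /continuousP_lt/(_ _ e2)[d d0 h] := fc p.
  have d2 : 0 < d / 2 by rewrite divr_gt0.
  exists (ball_ Num.norm p (d / 2), [set t | 0 < t < d / 2]).
    split => /=; first by apply/(@nbhs_normP R 'cV[R]_n); exists (d / 2).
    by near=> u; apply/andP; split; near: u; [exact: nbhs_right_gt|exact: nbhs_right_lt].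
  move=> [p' t] [/= pp' /andP[t0 td]]; split => // q qp'.
  have h1 : `|p' - p| < d by rewrite distrC; move: pp'; rewrite /ball_ /=; lra.
  have h2 : `|q - p| < d.
    rewrite -(subrKA p'); apply: le_lt_trans (ler_normD _ _) _.
    by rewrite [`|q - p'|]distrC [`|p' - p|]distrC; move: pp'; rewrite /ball_ /=; lra.
  rewrite -(subrKA (f p)); apply: le_trans (ler_normD _ _) _.
  rewrite [X in _ + X]distrC.
  by have := h _ h1; have := h _ h2; lra.
have [t [t0 ht]] := filter_ex (filterI (nbhs_right_gt (@GRing.zero R)) A).
by exists t => // p q px pq; have [_] := ht p px; exact.
Unshelve. all: by end_near. Qed.

(** For [0 <= d] this is a nonexpansive retraction onto the closed sup-norm ball; composing with it
    makes a continuous [f] uniformly continuous on the whole space without changing it on the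
    ball. *)
Definition clampv n (x : 'cV[R]_n) (d : R) (p : 'cV[R]_n) : 'cV[R]_n :=
  \col_i Num.max (x i 0 - d) (Num.min (p i 0) (x i 0 + d)).

Lemma clamp_le (l u b c m : R) : 0 <= m -> b - c <= m ->
  Num.max l (Num.min b u) - Num.max l (Num.min c u) <= m.
Proof.
move=> m0 bc.
case: (leP b u) => ?; case: (leP c u) => ?; [
  case: (leP l b) => ?; case: (leP l c) => ? |
  case: (leP l b) => ?; case: (leP l u) => ? |
  case: (leP l u) => ?; case: (leP l c) => ? |
  case: (leP l u) => ?]; lra.
Qed.

Lemma clampv_lip n (x : 'cV[R]_n) d p q : `|clampv x d p - clampv x d q| <= `|p - q|.
Proof.
apply: norm_le_coord => // i; apply: le_trans (coord_le_norm _ i).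
rewrite !mxE; apply/ler_normlP; split; rewrite ?opprB; apply: clamp_le => //.
  by rewrite distrC ler_norm.
exact: ler_norm.
Qed.

Lemma clampv_id n (x : 'cV[R]_n) d p : `|p - x| <= d -> clampv x d p = p.
Proof.
move=> pd; apply/colP => i; have := le_trans (coord_le_norm _ i) pd.
rewrite !mxE ler_norml => /andP[h1 h2].
by rewrite min_l ?max_r //; lra.
Qed.

Lemma clampv_in n (x : 'cV[R]_n) d p : 0 <= d -> `|clampv x d p - x| <= d.
Proof.
move=> d0; apply: norm_le_coord => // i; rewrite !mxE.
move: (x i 0) (p i 0) => a b; apply/ler_normlP.
case: (leP b (a + d)) => ?; last by case: (leP (a - d) (a + d)) => ?; split; lra.
by case: (leP (a - d) b) => ?; split; lra.
Qed.

(** The equation is solved exactly for smooth approximations of the clamped map. This gives points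
    where [f] is arbitrarily close to [y], and compactness supplies a point where the distance is
    zero. *)
Lemma local_surjective n (f : 'cV[R]_n -> 'cV[R]_n) a (x y : 'cV[R]_n) r d :
  continuous f -> expands f a x d ->
  0 < a -> 0 < r < d -> 2 * enorm (y - f x) < a * r ->
  exists2 z, `|z - x| <= r & f z = y.
Proof.
move=> fc fexp a0 /andP[r0 rd] ya.
have d0 : 0 < d by apply: lt_trans rd.
pose F0 p := f (clampv x d p).
have F0E p : `|p - x| < d -> F0 p = f p by move=> /ltW/clampv_id; rewrite /F0 => ->.
have F0u : ucont F0.
  move=> e e0; have [c c0 h] := @ucont_compact _ f x d _ fc e0.
  exists c => // p q pq; apply: h; first exact: clampv_in (ltW d0).
  exact: le_lt_trans (clampv_lip _ _ _ _) pq.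
have F0exp : expands F0 a x d.
  move=> u; have [v v1 h] := fexp u; exists v => // p px pux.
  by rewrite !F0E //; exact: h.
pose gap := a * r - 2 * enorm (y - f x).
have gap0 : 0 < gap by rewrite subr_gt0.
pose e1 := Num.min (d - r) (gap / 2 / n.+1%:R) / 2.
have approx e : 0 < e -> exists2 z, `|z - x| <= r & `|f z - y| <= e.
  move=> e0; pose e' := Num.min e e1.
  have m0 : 0 < Num.min (d - r) (gap / 2 / n.+1%:R).
    by rewrite lt_min subr_gt0 rd !divr_gt0.
  have e'0 : 0 < e' by rewrite lt_min e0 divr_gt0.
  have : e' < Num.min (d - r) (gap / 2 / n.+1%:R).
    by apply: (@le_lt_trans _ _ e1); [rewrite ge_min lexx orbT|rewrite /e1; lra].
  rewrite lt_min ltr_pdivlMr // => /andP[e'd e'g].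
  have [F [Fu FF0 Fexp FG]] := smoothing (index_enum 'I_n) F0u F0exp e'0.
  have [|||z zr Fz] := @smooth_surjective n F a x y r (d - e')%R Fu _ Fexp a0.
  - by move=> i; apply: FG; exact: mem_index_enum.
  - by rewrite r0; lra.
  - have := enorm_distD (f x) y (F x); have := enorm_le_norm (f x - F x).
    have := FF0 x; rewrite F0E ?subrr ?normr0 // distrC => h1 h2 h3.
    have : n.+1%:R * `|f x - F x| <= n.+1%:R * e' by rewrite ler_pM2l.
    move: gap0 e'g; rewrite /gap; lra.
  exists z => //; rewrite -(F0E _ (le_lt_trans zr rd)) -Fz distrC.
  by apply: le_trans (FF0 z) _; rewrite ge_min lexx.
have := @compact_EVT_min _ _ (fun q => enorm (f q - y)) _ _ (@compact_cVball n x r).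
case.
- by exists x; rewrite /= subrr normr0 ltW.
- apply: continuous_subspaceT => q.
  have h1 : {for q, continuous (fun q => f q - y)}.
    apply/continuousP_lt => e e0; have /continuousP_lt/(_ _ e0)[c c0 h] := fc q.
    by exists c => // p /h; rewrite opprB addrA subrK.
  have h2 := continuous_comp h1 (@enorm_continuous _ _).
  exact: h2.
move=> z; rewrite inE /= => zr zmin; exists z => //.
apply/eqP; rewrite -subr_eq0 -enorm_eq0 eq_le enorm_ge0 andbT.
apply/ler_addgt0Pr => e e0; rewrite add0r.
have [|q qr fq] := approx (e / n.+1%:R); first by rewrite divr_gt0.
apply: le_trans (zmin q _) _; first by rewrite inE.
by apply: le_trans (enorm_le_norm _) _; rewrite mulrC -ler_pdivlMr.
Qed.

(** * Riemann sums and positivity of the integral *)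

Section uniform_partition.
Variables (eta : R -> R) (a h : R) (xi : nat -> R).
Hypothesis h0 : 0 <= h.

Definition node (j : nat) : R := (a + j%:R * h)%R.

(** Each tag is paired with the right end of its cell; the left end of the first cell is the
    separate head of the subdivision. *)
Definition tagged_nodes k m : seq (R * R) := [seq (node j.+1, xi j) | j <- iota k m].

Lemma nodeS j : node j.+1 - node j = h.
Proof. by rewrite /node -natr1; ring. Qed.

Lemma Riemann_sum_uniform k m :
  SF_seq.Riemann_sum (V := Hierarchy.R_ModuleSpace) eta
    (SF_seq.mkSF_seq (node k) (tagged_nodes k m)) =
  \sum_(j <- iota k m) eta (xi j) * h :> R.
Proof.
rewrite /SF_seq.Riemann_sum /=.
have H w : foldr (@Hierarchy.plus Hierarchy.R_AbelianMonoid)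
    (@Hierarchy.zero Hierarchy.R_AbelianMonoid)
    (pairmap (fun x y : R * R => (@Hierarchy.scal _ Hierarchy.R_ModuleSpace)
       (Rminus y.1 x.1) (eta y.2)) (node k, w) (tagged_nodes k m))
   = \sum_(j <- iota k m) eta (xi j) * h :> R.
  elim: m k w => [|m IH] k w /=; first by rewrite big_nil.
  rewrite big_cons IH mulrC -(nodeS k); congr (_ + _).
exact: H.
Qed.

Lemma seq_step_uniform k m :
  SF_seq.seq_step (SF_seq.SF_lx (SF_seq.mkSF_seq (node k) (tagged_nodes k m))) <= h.
Proof.
rewrite /SF_seq.seq_step /=; elim: m k => [|m IH] k //=.
rewrite RmaxE ge_max IH RabsE RminusE nodeS ger0_norm // lexx //.
Qed.

Lemma last_uniform k m :
  last (node k) (unzip1 (tagged_nodes k m)) = node (k + m)%N.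
Proof.
elim: m k => [|m IH] k /=; first by rewrite addn0.
by rewrite IH addSnnS.
Qed.

Lemma pointed_uniform k m :
  (forall j, (k <= j < k + m)%N -> node j <= xi j <= node j.+1) ->
  SF_seq.pointed_subdiv (SF_seq.mkSF_seq (node k) (tagged_nodes k m)).
Proof.
move=> hxi i; rewrite /SF_seq.SF_size /= size_map size_iota => /ssrnat.ltP im.
rewrite /SF_seq.SF_lx /SF_seq.SF_ly /= /unzip1 /unzip2 -!map_comp.
rewrite (nth_map 0%N) ?size_iota // nth_iota //=.
have /andP[h1 h2] : node (k + i)%N <= xi (k + i)%N <= node (k + i).+1.
  by apply: hxi; rewrite leq_addr ltn_add2l.
split; apply/RleP; last by rewrite (nth_map 0%N) ?size_iota // nth_iota.
case: i im h1 {h2} => [|i] im h1 /=; first by rewrite addn0 in h1 *.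
have i_lt_m := ltnW im.
by rewrite (nth_map 0%N) ?size_iota // nth_iota //= -addnS.
Qed.

End uniform_partition.

(** A single [m] serves all choices of tags, so the tags may be adapted to [eta] once the partition
    is fixed. *)
Lemma uniform_Riemann_sums (eta : R -> R) (a b I e : R) : a < b ->
  is_RIntR eta a b I -> 0 < e ->
  exists m : nat, let h := (b - a) / m.+1%:R in
  forall xi, (forall j, (j <= m)%N -> node a h j <= xi j <= node a h j.+1) ->
    `|\sum_(j < m.+1) eta (xi j) * h - I| < e.
Proof.
move=> ab etaI e0.
have := etaI (fun y => `|y - I| < e); case.
  exists (RIneq.mkposreal e (elimT RltP e0)) => y.
  rewrite /Hierarchy.ball /= /Hierarchy.AbsRing_ball /Hierarchy.abs /=.
  by rewrite /Hierarchy.minus /Hierarchy.plus /Hierarchy.opp /= RabsE => /RltP.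
move=> [d /= /RltP d0] hd.
have [m hm] : exists m : nat, (b - a) / m.+1%:R < d.
  exists (Num.truncn ((b - a) / d)); rewrite ltr_pdivrMr // mulrC -ltr_pdivrMr //.
  exact: truncnS_gt.
exists m => /= xi hxi; set h := (b - a) / m.+1%:R in hm hxi *.
have h0 : 0 <= h by rewrite divr_ge0 // subr_ge0 ltW.
have n0 : node a h 0 = a by rewrite /node mul0r addr0.
have nm : node a h m.+1 = b.
  by rewrite /node /h mulrC divfK ?pnatr_eq0 // addrC subrK.
pose ptd := SF_seq.mkSF_seq (node a h 0) (tagged_nodes a h xi 0 m.+1).
have sumE : @Hierarchy.scal _ Hierarchy.R_ModuleSpace (Rcomplements.sign (Rminus b a))
    (SF_seq.Riemann_sum (V := Hierarchy.R_ModuleSpace) eta ptd) =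
    \sum_(j < m.+1) eta (xi j) * h :> R.
  have -> : Rcomplements.sign (Rminus b a) = 1%R.
    by apply: Rcomplements.sign_eq_1; apply/RltP; rewrite RminusE subr_gt0.
  rewrite /ptd Riemann_sum_uniform -[RHS](big_mkord xpredT (fun j => eta (xi j) * h)).
  rewrite /index_iota subn0; exact: mul1r.
move: hd => /(_ ptd); rewrite [X in `|X - I|]sumE; apply.
- by apply/RltP; apply: le_lt_trans hm; exact: seq_step_uniform.
- split; first by apply: pointed_uniform => j /andP[_]; rewrite add0n ltnS => /hxi.
  rewrite RminE RmaxE min_l ?max_r ?ltW //; split; first by rewrite /= n0.
  by rewrite [LHS](last_uniform a h xi 0 m.+1) add0n.
Qed.

Lemma improper_integral_near (eta : R -> R) (rho sigma c e : R) :
  is_Riemann_integral_co eta 0%R rho sigma -> c < rho -> 0 < e ->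
  exists t I, [/\ c < t < rho, is_RIntR eta 0%R t I & `|I - sigma| < e].
Proof.
move=> etaI cr e0.
have [|Q P Q0 Pr h] := etaI (fun y => `|y - sigma| < e).
  exists (RIneq.mkposreal e (elimT RltP e0)) => y.
  rewrite /Hierarchy.ball /= /Hierarchy.AbsRing_ball /Hierarchy.abs /=.
  by rewrite /Hierarchy.minus /Hierarchy.plus /Hierarchy.opp /= RabsE => /RltP.
have [[d d0'] Pd] := Pr; have d0 : 0 < d by apply/RltP.
pose t := Num.max (rho - d / 2) ((c + rho) / 2).
have t1 : rho - d / 2 <= t by rewrite le_max lexx.
have t2 : (c + rho) / 2 <= t by rewrite le_max lexx orbT.
have t3 : t < rho by rewrite gt_max; apply/andP; split; lra.
have [|I [/= tI Ie]] := h 0%R t Q0.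
  apply: Pd; last exact/RltP.
  rewrite /Hierarchy.ball /= /Hierarchy.AbsRing_ball /Hierarchy.abs /=.
  rewrite /Hierarchy.minus /Hierarchy.plus /Hierarchy.opp /= RabsE; apply/RltP.
  by rewrite RplusE RoppE ltr_norml; lra.
by exists t, I; split=> //; lra.
Qed.

(** Every cell contains a tag where [eta] is at least [c]; the Riemann sums with these tags are at
    least [c * (b - a)]. *)
Lemma RInt_ge_dense (eta : R -> R) (a b I c : R) : a < b -> is_RIntR eta a b I ->
  (forall p q, a <= p -> p < q -> q <= b -> exists2 s, p <= s <= q & c <= eta s) ->
  c * (b - a) <= I.
Proof.
move=> ab etaI dense; apply/ler_addgt0Pr => e e0.
have [m /= hm] := uniform_Riemann_sums ab etaI e0.
set h := (b - a) / m.+1%:R in hm.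
have h0 : 0 < h by rewrite divr_gt0 // subr_gt0.
have mh : m.+1%:R * h = b - a by rewrite mulrC divfK ?pnatr_eq0.
have ex j : exists s, (j <= m)%N -> node a h j <= s <= node a h j.+1 /\ c <= eta s.
  have [jm|] := leqP j m; last by exists 0.
  have [|||s s1 s2] := dense (node a h j) (node a h j.+1); last by exists s.
  - by rewrite lerDl mulr_ge0 // ltW.
  - by rewrite -subr_gt0 nodeS.
  - rewrite /node -lerBrDl -mh ler_pM2r // ler_nat.
    exact: jm.
have [xi hxi] := choice ex.
have := hm xi (fun j jm => proj1 (hxi j jm)).
have : \sum_(j < m.+1) c * h <= \sum_(j < m.+1) eta (xi j) * h.
  apply: ler_sum => j _; rewrite ler_pM2r //.
  by have [] := hxi j (leq_ord j).
rewrite sumr_const card_ord -mulrnAr -[h *+ _]mulr_natl mh ltr_norml; lra.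
Qed.

Lemma integral_gt0 (eta : R -> R) (rho sigma : R) : 0 < rho ->
  (forall t, 0 <= t < rho -> 0 < eta t) ->
  is_Riemann_integral_co eta 0%R rho sigma -> 0 < sigma.
Proof.
move=> rho0 eta0 etaI.
pose E (k : nat) : set R^o := [set s | 0 < s < rho /\ k.+1%:R^-1 <= eta s].
have oI : open ([set s | 0 < s < rho] : set R^o).
  rewrite (_ : [set s | 0 < s < rho] = `]0, rho[%classic :> set R^o).
    exact: interval_open.
  by apply/seteqP; split => s /=; rewrite in_itv.
have [k [W [W0 Wo WE]]] : exists k (W : set R^o),
    [/\ W !=set0, open W & W `<=` closure (E k)].
  apply: contrapT => nex.
  (* If no closure of an [E k] had interior, Baire's theorem would give a point of []0, rho[]
     outside all [E k], although [eta] is positive there. *)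
  have dns : dense (\bigcap_k (~` closure (E k))).
    apply: (@Baire R R^o) => k; split; first exact/closed_openC/closed_closure.
    move=> W W0 Wo; apply: contrapT => nO; apply: nex; exists k, W; split => // s Os.
    by apply: contrapT => ns; apply: nO; exists s.
  have [||s [sI Es]] := dns [set s | 0 < s < rho] => //.
    by exists (rho / 2); apply/andP; split; lra.
  have /andP[s0 sr] := sI; have es0 : 0 < eta s by apply: eta0; rewrite ltW.
  pose k := Num.truncn (eta s)^-1.
  have ks : k.+1%:R^-1 <= eta s.
    by rewrite -[leRHS]invrK lef_pV2 ?posrE ?invr_gt0 // ltW // truncnS_gt.
  by have := Es k Logic.I; apply; apply: subset_closure; split.
have [w0 Wo'] := W0.
(* [W] may leave []0, rho[]; a point of [E k] inside [W] gives an interval contained in both. *)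
have [e [[/andP[e0 er] _] Oe]] : E k `&` W !=set0.
  by apply: (WE _ Wo'); exact: open_nbhs_nbhs.
have : nbhs e (W `&` [set s | 0 < s < rho]).
  by apply: open_nbhs_nbhs; split; [exact: openI|split=> //; apply/andP].
move=> /(@nbhs_normP R R^o)[d /= d0 dW].
pose a := e - d / 2; pose b := e + d / 2; have ab : a < b by rewrite /a /b; lra.
have abW s : a <= s <= b -> W s /\ 0 < s < rho.
  move=> sab; apply: dW; rewrite /ball_ /= distrC ltr_norml.
  by move: sab; rewrite /a /b; lra.
have [_ /andP[a0 ar]] : W a /\ 0 < a < rho by apply: abW; rewrite lexx ltW.
have [_ /andP[b0 br]] : W b /\ 0 < b < rho by apply: abW; rewrite lexx ltW.
have dense p q : a <= p -> p < q -> q <= b ->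
    exists2 s, p <= s <= q & k.+1%:R^-1 <= eta s.
  move=> ap pq qb.
  have /WE/closure_norm/(_ ((q - p) / 2)) : W ((p + q) / 2).
    by have [] // := abW ((p + q) / 2); lra.
  case=> [|s [_ hs] sm]; first by rewrite divr_gt0 // subr_gt0.
  by exists s => //; move: sm; rewrite ltr_norml; lra.
(* This bounds the integral over [[a, b]] from below, so it is also an admissible error in
   approximating [sigma] by a proper integral. *)
have g0 : 0 < k.+1%:R^-1 * (b - a) by rewrite mulr_gt0 ?invr_gt0 // subr_gt0.
have [t [I [/andP[bt tr] tI Isigma]]] := improper_integral_near etaI br g0.
pose ex := @RInt.ex_RInt Hierarchy.R_NormedModule eta.
have ex0t : ex 0%R t by exists I.
have ex0b : ex 0%R b.
  apply: (@RInt.ex_RInt_Chasles_1 Hierarchy.R_CompleteNormedModule) ex0t.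
  by split; apply/RleP; rewrite ltW.
have exbt : ex b t.
  apply: (@RInt.ex_RInt_Chasles_2 Hierarchy.R_CompleteNormedModule) ex0t.
  by split; apply/RleP; rewrite ltW.
have ex0a : ex 0%R a.
  apply: (@RInt.ex_RInt_Chasles_1 Hierarchy.R_CompleteNormedModule) ex0b.
  by split; apply/RleP; rewrite ltW.
have exab : ex a b.
  apply: (@RInt.ex_RInt_Chasles_2 Hierarchy.R_CompleteNormedModule) ex0b.
  by split; apply/RleP; rewrite ltW.
have [I1 i1] := ex0a; have [I2 i2] := exab; have [I3 i3] := exbt.
have I2_ge := RInt_ge_dense ab i2 dense.
have nneg p q J : 0 <= p -> p <= q -> q < rho -> is_RIntR eta p q J -> 0 <= J.
  move=> p0 pq qr iJ; apply/RleP.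
  apply: (@RInt.is_RInt_ge_0 eta p q J) => //; first exact/RleP.
  move=> s [/RltP ps /RltP sq]; apply/RleP/ltW/eta0.
  by rewrite (le_trans p0 (ltW ps)) (lt_trans sq).
have I1_ge : 0 <= I1 by apply: nneg i1 => //; exact: ltW.
have I3_ge : 0 <= I3 by apply: nneg i3 => //; exact: ltW.
have -> : sigma = sigma - I + (I1 + I2 + I3).
  suff -> : I = I1 + I2 + I3 by rewrite subrK.
  rewrite -(@RInt.is_RInt_unique Hierarchy.R_CompleteNormedModule _ _ _ _ tI).
  apply: (@RInt.is_RInt_unique Hierarchy.R_CompleteNormedModule).
  apply: (@RInt.is_RInt_Chasles Hierarchy.R_NormedModule) i3.
  exact: (@RInt.is_RInt_Chasles Hierarchy.R_NormedModule) i1 i2.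
move: Isigma I2_ge I1_ge I3_ge; rewrite ltr_norml; move: (_ * (b - a)) => g.
move: I1 I2 I3 {i1 i2 i3} => x y z; lra.
Qed.

(** * A lower step function and its primitive *)

(** For [0 <= h], the length of the part of [[p, p + h]] below [s]: a primitive of the indicator
    function of that cell. *)
Definition clip (h p s : R) : R := Num.min h (Num.max 0 (s - p)).

Lemma clip_le (h p s s' : R) : s <= s' -> clip h p s <= clip h p s'.
Proof.
move=> ss'; rewrite /clip.
case: (leP 0 (s - p)) => ?; case: (leP 0 (s' - p)) => ?; [
  case: (leP h (s - p)) => ?; case: (leP h (s' - p)) => ? |
  case: (leP h (s - p)) => ?; case: (leP h 0) => ? |
  case: (leP h 0) => ?; case: (leP h (s' - p)) => ? |
  case: (leP h 0) => ?]; lra.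
Qed.

Lemma clip_diff_le (h s s' : R) : s <= s' -> clip h 0 s' - clip h 0 s <= s' - s.
Proof.
move=> ss'; rewrite /clip !subr0.
case: (leP 0 s) => ?; case: (leP 0 s') => ?; [
  case: (leP h s) => ?; case: (leP h s') => ? |
  case: (leP h s) => ?; case: (leP h 0) => ? |
  case: (leP h 0) => ?; case: (leP h s') => ? |
  case: (leP h 0) => ?]; lra.
Qed.

Lemma sum_clip (h s : R) k : 0 <= h ->
  \sum_(j < k) clip h (node 0 h j) s = clip (k%:R * h)%R 0 s.
Proof.
move=> h0; elim: k => [|k IH].
  by rewrite big_ord0 mul0r /clip min_l // le_max lexx.
rewrite big_ord_recr /= IH /clip /node add0r subr0 -natr1 mulrDl mul1r.
have : 0 <= k%:R * h by rewrite mulr_ge0.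
move: (k%:R * h) => c c0.
case: (leP 0 s) => ?; case: (leP 0 (s - c)) => ?; [
  case: (leP c s) => ?; case: (leP h (s - c)) => ?; case: (leP (c + h) s) => ? |
  case: (leP c s) => ?; case: (leP h 0) => ?; case: (leP (c + h) s) => ? |
  lra |
  case: (leP c 0) => ?; case: (leP h 0) => ?; case: (leP (c + h) 0) => ?]; lra.
Qed.

Lemma clip_local (h p s0 : R) : 0 <= h -> ~~ (p <= s0 <= p + h) ->
  exists2 d, 0 < d & forall s s', `|s - s0| < d -> `|s' - s0| < d ->
    clip h p s = clip h p s'.
Proof.
move=> h0; rewrite negb_and -!ltNge => /orP[sp|ps].
  exists (p - s0); first by rewrite subr_gt0.
  move=> s s'; rewrite !ltr_norml => /andP[_ s1] /andP[_ s'1].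
  by rewrite /clip !max_l //; lra.
exists (s0 - (p + h)); first by rewrite subr_gt0.
move=> s s'; rewrite !ltr_norml => /andP[s1 _] /andP[s'1 _].
by rewrite /clip !min_l // le_max; apply/orP; right; lra.
Qed.

(* [Psi] is a primitive of a lower Darboux step function of [eta]. The step
   values lie below [eta] on closed intervals, so that the bound on the local
   slope of [Psi] also holds at the nodes. *)
Lemma slope_function (eta : R -> R) (rho sigma r : R) :
  is_Riemann_integral_co eta 0%R rho sigma -> 0 < rho -> r < sigma ->
  (forall t, 0 <= t < rho -> 0 < eta t) ->
  exists t Psi, [/\ 0 < t < rho, Psi 0 = 0 :> R,
    {homo Psi : x y / x <= y :> R >-> x <= y :> R}, r < Psi t &
    forall s0, 0 <= s0 < rho -> exists2 a, 0 <= a < eta s0 &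
      exists2 d, 0 < d & forall s s', `|s - s0| < d -> `|s' - s0| < d ->
        s <= s' -> Psi s' - Psi s <= a * (s' - s)].
Proof.
move=> etaI rho0 rsigma eta0.
have e0 : 0 < sigma - r by rewrite subr_gt0.
have [t [I [/andP[t0 tr] tI]]] := improper_integral_near etaI rho0 e0.
rewrite ltr_norml => /andP[Ir _].
have {}Ir : 0 < I - r by lra.
have [m hm] := uniform_Riemann_sums t0 tI (divr_gt0 Ir (ltr0Sn _ 1)).
rewrite /= subr0 in hm; set h := t / m.+1%:R in hm.
have h0 : 0 < h by rewrite divr_gt0.
have mh : m.+1%:R * h = t by rewrite mulrC divfK ?pnatr_eq0.
(* The Riemann sum is within [(I - r) / 2] of [I], and passing to the step values costs at most
   [ep * 2] per unit length, another [(I - r) / 2] in all; the total stays above [r]. *)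
pose ep := (I - r) / (4 * t).
have ep0 : 0 < ep by rewrite divr_gt0 // mulr_gt0.
have ept : ep * t * 2 = (I - r) / 2 by rewrite /ep; field; rewrite gt_eqF.
have node_ge0 j : 0 <= node 0 h j by rewrite /node add0r mulr_ge0 // ltW.
have node_lt j : (j <= m)%N -> node 0 h j.+1 < rho.
  move=> jm; apply: le_lt_trans tr; rewrite /node add0r -mh ler_pM2r // ler_nat.
  exact: jm.
have ex j : exists cx : R * R, (j <= m)%N ->
    [/\ 0 <= cx.1, node 0 h j <= cx.2 <= node 0 h j.+1, eta cx.2 <= cx.1 + ep * 2 &
      forall s, node 0 h j <= s <= node 0 h j.+1 -> cx.1 < eta s].
  have [jm|] := leqP j m; last by exists (0, 0).
  pose E := [set eta s | s in [set s | node 0 h j <= s <= node 0 h j.+1]].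
  have Epos s : node 0 h j <= s <= node 0 h j.+1 -> 0 < eta s.
    move=> /andP[s1 s2]; apply: eta0.
    by rewrite (le_trans (node_ge0 j)) //= (le_lt_trans s2) // node_lt.
  have Einf : has_inf E.
    split; last by exists 0 => _ [s /Epos/ltW ? <-].
    exists (eta (node 0 h j)), (node 0 h j) => //=.
    by rewrite lexx -subr_ge0 nodeS ltW.
  have [_ [xi /= xiI <-] xiE] := inf_adherent ep0 Einf.
  (* Subtracting [ep] puts the value strictly below [eta] even where the infimum is attained; the
     maximum with 0 keeps [Psi] nondecreasing. *)
  exists (Num.max 0 (inf E - ep), xi); split => //=.
  - by rewrite le_max lexx.
  - have : inf E - ep <= Num.max 0 (inf E - ep) by rewrite le_max lexx orbT.
    lra.
  - move=> s sI; rewrite gt_max Epos //=.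
    have : inf E <= eta s by apply: ge_inf; [case: Einf|exists s].
    lra.
have [cx hcx] := choice ex.
pose c j := (cx j).1; pose xi j := (cx j).2.
pose Psi s := \sum_(j < m.+1) c j * clip h (node 0 h j) s.
exists t, Psi; split.
- by rewrite t0.
- apply: big1 => j _; rewrite /clip sub0r max_l ?oppr_le0 // min_r ?mulr0 //.
  exact: ltW.
- move=> s s' ss'; apply: ler_sum => j _; apply: ler_wpM2l; last exact: clip_le.
  by have [] := hcx j (leq_ord j).
- have := hm xi (fun j jm => let: And4 _ p _ _ := hcx j jm in p).
  have -> : Psi t = \sum_(j < m.+1) c j * h.
    apply: eq_bigr => j _; rewrite /clip.
    have : node 0 h j.+1 <= t.
      by rewrite /node add0r -mh ler_pM2r // ler_nat; exact: ltn_ord.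
    have := nodeS 0 h j => jS jt; rewrite min_l // le_max; apply/orP; right; lra.
  have : \sum_(j < m.+1) eta (xi j) * h <= \sum_(j < m.+1) (c j * h + ep * 2 * h).
    apply: ler_sum => j _; rewrite -mulrDl ler_pM2r //.
    by have [] := hcx j (leq_ord j).
  rewrite big_split /= sumr_const card_ord -mulrnAr -[h *+ _]mulr_natl mh.
  rewrite ltr_norml; lra.
move=> s0 s0I.
pose P (j : 'I_m.+1) := node 0 h j <= s0 <= node 0 h j.+1.
(* A node belongs to two closed cells, and both step values lie below [eta s0]; beyond [t] there is
   no cell and [a] is 0. *)
pose a := \big[Num.max/0]_(j < m.+1 | P j) c j.
exists a.
  apply/andP; split; first exact: bigmax_ge_id.
  apply: bigmax_lt => [|j Pj]; first exact: eta0.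
  by have [_ _ _] := hcx j (leq_ord j); apply.
have a0 : 0 <= a by exact: bigmax_ge_id.
have exd (j : 'I_m.+1) : exists d, 0 < d /\ forall s s',
    `|s - s0| < d -> `|s' - s0| < d -> s <= s' ->
    c j * (clip h (node 0 h j) s' - clip h (node 0 h j) s) <=
    a * (clip h (node 0 h j) s' - clip h (node 0 h j) s).
  have [Pj|Pj] := boolP (P j).
    exists 1; split => // s s' _ _ ss'; apply: ler_wpM2r.
      by rewrite subr_ge0; exact: clip_le.
    exact: le_bigmax_cond.
  have hE : node 0 h j.+1 = node 0 h j + h by have := nodeS 0 h j; lra.
  rewrite /P hE in Pj.
  have [d d0 hd] := clip_local (ltW h0) Pj.
  by exists d; split => // s s' sd s'd _; rewrite (hd s s') // subrr !mulr0.
have [d hd] := choice exd.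
exists (\big[Num.min/1]_(j < m.+1) d j).
  by apply: lt_bigmin => // j _; have [] := hd j.
move=> s s' sd s'd ss'.
have -> : Psi s' - Psi s = \sum_(j < m.+1)
    c j * (clip h (node 0 h j) s' - clip h (node 0 h j) s).
  by rewrite -sumrB; apply: eq_bigr => j _; rewrite mulrBr.
(* Near [s0] only the cells containing it contribute increments. Once each coefficient is replaced
   by [a], the increments add up to that of one clip over [[0, t]]. *)
apply: (@le_trans _ _ (a * (clip t 0 s' - clip t 0 s))).
  rewrite -mh -!sum_clip ?(ltW h0) // -sumrB mulr_sumr. apply: ler_sum => j _.
  have [_] := hd j; apply => //.
    by apply: lt_le_trans sd _; exact: bigmin_le.
  by apply: lt_le_trans s'd _; exact: bigmin_le.
by apply: ler_wpM2l => //; exact: clip_diff_le.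
Qed.

(* Along a lift of a segment traversed at unit speed, [Psi] of the distance to
   [x0] grows at most at unit speed. *)
Definition tame n (f : 'cV[R]_n -> 'cV[R]_n) (Psi : R -> R) x0 (a : R) x (d : R) :=
  expands f a x d /\ forall p q, `|p - x| < d -> `|q - x| < d ->
    Psi (enorm (p - x0)) - Psi (enorm (q - x0)) <= a * enorm (p - q).

(** * Lifting of segments *)

Lemma tame_sub n (f : 'cV[R]_n -> 'cV[R]_n) Psi x0 a x d x' d' :
  tame f Psi x0 a x d -> `|x' - x| + d' <= d -> tame f Psi x0 a x' d'.
Proof.
move=> [fexp hPsi] xd.
have sub p : `|p - x'| < d' -> `|p - x| < d.
  by move=> px; rewrite -(subrKA x'); apply: le_lt_trans (ler_normD _ _) _; lra.
split=> [u|p q /sub px /sub qx]; last exact: hPsi.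
have [v v1 h] := fexp u; exists v => // p /sub px /sub pux; exact: h.
Qed.

(** By compactness one [d] bounds from below both the radius and the expansion constant, so a step
    length depending on [d] alone works throughout the ball. *)
Lemma uniformly_tame n (f : 'cV[R]_n -> 'cV[R]_n) Psi (x0 : 'cV[R]_n) t :
  (forall x, enorm (x - x0) <= t -> exists a d, [/\ 0 < a, 0 < d & tame f Psi x0 a x d]) ->
  exists2 d, 0 < d & forall x, enorm (x - x0) <= t ->
    exists2 a, d <= a & tame f Psi x0 a x d.
Proof.
move=> loc.
have cK : compact [set x : 'cV[R]_n | enorm (x - x0) <= t].
  apply: subclosed_compact (@compact_cVball n x0 t) _; last first.
    by move=> x /=; exact/le_trans/norm_le_enorm.
  rewrite (_ : [set _ | _] = (fun x : 'cV[R]_n => enorm (x - x0)) @^-1` [set s | s <= t]) //.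
  apply: closed_comp; last exact: closed_le.
  move=> x _; have h1 : {for x, continuous (fun q : 'cV[R]_n => q - x0)}.
    by apply/continuousP_lt => e e0; exists e => // p; rewrite opprB addrA subrK.
  have h2 := continuous_comp h1 (@enorm_continuous _ _); exact: h2.
have /compact_near_coveringP cov := cK.
pose P (d : R) x := 0 < d /\ exists2 a, d <= a & tame f Psi x0 a x d.
have A : \forall d \near (@GRing.zero R)^'+, [set x | enorm (x - x0) <= t] `<=` P d.
  apply: cov => x /loc[a [d [a0 d0 fx]]].
  have d2 : 0 < d / 2 by rewrite divr_gt0.
  exists (ball_ Num.norm x (d / 2), [set s | 0 < s < Num.min a (d / 2)]).
    split => /=; first by apply/(@nbhs_normP R 'cV[R]_n); exists (d / 2).
    near=> u; apply/andP; split; near: u; first exact: nbhs_right_gt.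
    by apply: nbhs_right_lt; rewrite lt_min a0.
  move=> [x' s] [/= xx' /andP[s0]]; rewrite lt_min => /andP[sa sd]; split => //.
  exists a; first exact: ltW.
  by apply: tame_sub fx _; rewrite distrC; move: xx'; rewrite /ball_ /=; lra.
have [d [d0 hd]] := filter_ex (filterI (nbhs_right_gt (@GRing.zero R)) A).
by exists d => // x /hd[].
Unshelve. all: by end_near. Qed.

Lemma expands_inj n (f : 'cV[R]_n -> 'cV[R]_n) a x d p q : 0 < a ->
  expands f a x d -> `|p - x| < d -> `|q - x| < d -> f p = f q -> p = q.
Proof.
move=> a0 fexp px qx fpq; have := expands_le fexp px qx.
rewrite fpq subrr enorm0 pmulr_rle0 // => h.
apply/esym/eqP; rewrite -subr_eq0 -enorm_eq0 eq_le h enorm_ge0 //.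
Qed.

(** The constant 8 comes from solving within radius [d / 4]: twice the distance from [f x] to [z] is
    below [d * d / 4], hence below [a * (d / 4)]. The growth of [Psi] is at most
    [a * enorm (p - x)], which expansion bounds by the length of the step. *)
Lemma lift_step n (f : 'cV[R]_n -> 'cV[R]_n) Psi x0 a x d z : continuous f ->
  0 < d -> d <= a -> tame f Psi x0 a x d -> enorm (z - f x) < d * d / 8 ->
  exists p, [/\ `|p - x| <= d / 4, f p = z &
    Psi (enorm (p - x0)) <= Psi (enorm (x - x0)) + enorm (z - f x)].
Proof.
move=> fc d0 da [fexp hPsi] zx; have a0 : 0 < a by apply: lt_le_trans da.
have [||p px fp] := @local_surjective n f a x z (d / 4) d fc fexp a0.
- by rewrite divr_gt0 //=; lra.
- have : d * d <= a * d by rewrite ler_pM2r.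
  lra.
exists p; split=> //; have pd : `|p - x| < d by lra.
have xd : `|x - x| < d by rewrite subrr normr0.
have := hPsi p x pd xd; have := expands_le fexp xd pd; rewrite fp; lra.
Qed.

(** All segments issued from [f x0] are cut into [N.+1] equal pieces; the induction on [k] builds
    the lift of the points at fraction [k / N.+1] as a continuous function of the endpoint. *)
Lemma lift_ball n (f : 'cV[R]_n -> 'cV[R]_n) (Psi : R -> R) (x0 : 'cV[R]_n) t r :
  continuous f -> {homo Psi : x y / x <= y :> R >-> x <= y :> R} -> Psi 0 = 0 ->
  (forall x, enorm (x - x0) <= t -> exists a d, [/\ 0 < a, 0 < d & tame f Psi x0 a x d]) ->
  0 < r < Psi t ->
  exists g, g (f x0) = x0 /\ forall y, enorm (y - f x0) < r ->
    [/\ f (g y) = y, enorm (g y - x0) < t & {for y, continuous g}].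
Proof.
move=> fc Psi_homo Psi0 loc /andP[r0 rt].
have [d d0 hd] := uniformly_tame loc; set y0 := f x0.
have dd0 : 0 < d * d / 8 by rewrite divr_gt0 // mulr_gt0.
pose N := Num.truncn (r / (d * d / 8)).
have hN : r / N.+1%:R < d * d / 8.
  by rewrite ltr_pdivrMr // mulrC -ltr_pdivrMr // truncnS_gt.
pose yk (k : nat) y := y0 + (k%:R / N.+1%:R) *: (y - y0).
(* Since [r < Psi t], the bound on [Psi] confines the lift to the ball where steps of uniform size
   are possible. *)
have t_bound x : Psi (enorm (x - x0)) <= r -> enorm (x - x0) < t.
  by move=> xr; rewrite ltNge; apply/negP => /Psi_homo; lra.
have lift k : (k <= N.+1)%N -> exists g, g y0 = x0 /\ forall y, enorm (y - y0) < r ->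
    [/\ f (g y) = yk k y, Psi (enorm (g y - x0)) <= k%:R / N.+1%:R * enorm (y - y0) &
        {for y, continuous g}].
  elim: k => [_|k IH kN].
    exists (fun=> x0); split => // y yr; split; last exact: cst_continuous.
    - by rewrite /yk mulr0n mul0r scale0r addr0.
    - by rewrite subrr enorm0 Psi0 mulr0n !mul0r.
  have [g [g0 hg]] := IH (ltnW kN).
  have k1 : k%:R / N.+1%:R <= 1 :> R by rewrite ler_pdivrMr // mul1r ler_nat ltnW.
  have k1' : k.+1%:R / N.+1%:R <= 1 :> R by rewrite ler_pdivrMr // mul1r ler_nat.
  have tameg y : enorm (y - y0) < r -> exists2 a, d <= a & tame f Psi x0 a (g y) d.
    move=> yr; apply/hd/ltW/t_bound; have [_ h _] := hg y yr.
    apply: le_trans h _; apply: (@le_trans _ _ (enorm (y - y0))); last exact: ltW.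
    by rewrite ler_piMl // enorm_ge0.
  have yS y : yk k.+1 y - yk k y = N.+1%:R^-1 *: (y - y0).
    rewrite /yk opprD addrACA subrr add0r -scalerBl -mulrBl -[k.+1%:R]natr1.
    by congr (_ *: _); rewrite addrAC subrr add0r mul1r.
  have ex y : exists p, enorm (y - y0) < r -> [/\ `|p - g y| <= d / 4, f p = yk k.+1 y &
      Psi (enorm (p - x0)) <= k.+1%:R / N.+1%:R * enorm (y - y0)].
    have [yr|] := ltP (enorm (y - y0)) r; last by exists 0.
    have [a da ta] := tameg y yr; have [fg gP _] := hg y yr.
    have yE : enorm (yk k.+1 y - f (g y)) = N.+1%:R^-1 * enorm (y - y0).
      by rewrite fg yS enormZ ger0_norm.
    have [|p [p1 p2 p3]] := @lift_step n f Psi x0 a (g y) d (yk k.+1 y) fc d0 da ta.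
      rewrite yE; apply: le_lt_trans hN; rewrite mulrC ler_pM2r ?invr_gt0 //.
      exact: ltW.
    exists p; split => //; apply: le_trans p3 _; rewrite yE.
    by rewrite -[k.+1%:R]natr1 mulrDl mulrDl mul1r lerD2r.
  have [g' hg'] := choice ex.
  have y00 : enorm (y0 - y0) < r by rewrite subrr enorm0.
  exists g'; split.
    (* Over the centre the segment is constant, and local injectivity keeps the chosen lift at
       [x0]. *)
    have [a da [fexp _]] := tameg y0 y00; have [p1 p2 _] := hg' y0 y00.
    rewrite -[RHS]g0; apply: (expands_inj (lt_le_trans d0 da) fexp); first lra.
      by rewrite subrr normr0.
    by rewrite p2 g0 /yk subrr scaler0 addr0.
  move=> y yr; have [p1 p2 p3] := hg' y yr; split=> //.
  have [a da [fexp _]] := tameg y yr; have [_ _ /continuousP_lt gc] := hg y yr.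
  have a0 : 0 < a by apply: lt_le_trans da.
  apply/continuousP_lt => e e0.
  have [|c c0 hc] := gc (d / 2); first by rewrite divr_gt0.
  pose c1 := a * e / n.+1%:R; have c10 : 0 < c1 by rewrite divr_gt0 // mulr_gt0.
  pose c2 := (r - enorm (y - y0)) / n.+1%:R.
  have c20 : 0 < c2 by rewrite divr_gt0 // subr_gt0.
  exists (Num.min c (Num.min c1 c2)); first by rewrite !lt_min c0 c10.
  move=> y'; rewrite !lt_min => /and3P[/hc gy'].
  rewrite !ltr_pdivlMr // ![_ * n.+1%:R]mulrC => yc1 yc2.
  have yy' := enorm_le_norm (y' - y).
  have y'r : enorm (y' - y0) < r by apply: le_lt_trans (enorm_distD y _ _) _; lra.
  have [q1 q2 _] := hg' y' y'r.
  (* A step moves by at most [d / 4] and [g] varies by less than [d / 2], so both new lifts lie in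
     one ball of expansion; there the inverse is Lipschitz with constant [1 / a]. *)
  have qd : `|g' y' - g y| < d.
    by rewrite -(subrKA (g y')); apply: le_lt_trans (ler_normD _ _) _; lra.
  have pd : `|g' y - g y| < d by lra.
  have := expands_le fexp pd qd; rewrite p2 q2 /yk opprD addrACA subrr add0r.
  rewrite -scalerBr opprB addrA subrK enormZ ger0_norm ?divr_ge0 // => h.
  apply: le_lt_trans (norm_le_enorm _) _; rewrite -(ltr_pM2l a0).
  apply: le_lt_trans h _; apply: (@le_lt_trans _ _ (enorm (y' - y))); last lra.
  by rewrite ler_piMl // enorm_ge0.
have [g [g0 hg]] := lift N.+1 (leqnn _).
exists g; split => // y yr; have [h1 h2 h3] := hg y yr.
have N1 : N.+1%:R / N.+1%:R = 1 :> R by rewrite divff // pnatr_eq0.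
split=> //; first by rewrite h1 /yk N1 scale1r addrC subrK.
by apply: t_bound; move: h2; rewrite N1 mul1r; move/le_trans; apply; exact: ltW.
Qed.

(** Along a ray the distance [gap] between the two sections is continuous, and once zero it stays
    zero for a while by local injectivity. *)
Lemma sections_agree n (f g1 g2 : 'cV[R]_n -> 'cV[R]_n) (y0 : 'cV[R]_n) r :
  (forall y, enorm (y - y0) < r ->
     [/\ f (g1 y) = y, f (g2 y) = y, {for y, continuous g1}, {for y, continuous g2} &
       exists2 d, 0 < d &
         forall p q, `|p - g1 y| < d -> `|q - g1 y| < d -> f p = f q -> p = q]) ->
  g1 y0 = g2 y0 -> forall y, enorm (y - y0) < r -> g1 y = g2 y.
Proof.
move=> hg g0 y yr; pose ray (s : R) := y0 + s *: (y - y0).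
pose gap s := `|g1 (ray s) - g2 (ray s)|.
have gap0 : gap 0 = 0 by rewrite /gap /ray scale0r addr0 g0 subrr normr0.
have ray1 : ray 1 = y by rewrite /ray scale1r addrC subrK.
have ray_ball s : 0 <= s <= 1 -> enorm (ray s - y0) < r.
  move=> /andP[s0 s1]; rewrite /ray addrC addKr enormZ ger0_norm //.
  by apply: le_lt_trans yr; rewrite ler_piMl // enorm_ge0.
have ray_cont g s : {for ray s, continuous g} ->
    {for s, continuous (g \o ray : R -> 'cV[R]_n)}.
  by move=> gc; apply: continuous_comp gc; exact: line_continuous.
suff : gap 1 <= gap 0.
  by rewrite gap0 /gap normr_le0 ray1 subr_eq0 => /eqP.
apply: le_endpoints => //.
  move=> s s01; have [_ _ c1 c2 _] := hg _ (ray_ball s s01).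
  have h1 := ray_cont _ _ c1; have h2 := ray_cont _ _ c2.
  have h3 := cvg_norm (cvgB h1 h2).
  exact: h3.
move=> s /andP[s0 s1]; rewrite gap0 normr_le0 subr_eq0 => /eqP g12.
have s01 : 0 <= s <= 1 by rewrite s0 ltW.
have [_ _ c1 c2 [d d0 inj]] := hg _ (ray_ball s s01).
have /(@continuousP_lt R^o)/(_ _ d0)[d1 d10 h1] := ray_cont _ _ c1.
have /(@continuousP_lt R^o)/(_ _ d0)[d2 d20 h2] := ray_cont _ _ c2.
exists (Num.min (1 - s) (Num.min d1 d2)); first by rewrite !lt_min d10 d20 subr_gt0 s1.
move=> t /andP[st]; rewrite -ltrBlDl !lt_min => /and3P[t1 td1 td2].
have t01 : 0 <= t <= 1 by apply/andP; split; lra.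
have tpos : `|t - s| = t - s by rewrite ger0_norm // subr_ge0 ltW.
have [f1 f2 _ _ _] := hg _ (ray_ball t t01).
have -> : gap t = 0.
  apply/eqP; rewrite normr_eq0 subr_eq0; apply/eqP; apply: inj.
  - by apply: h1; rewrite tpos.
  - by rewrite g12; apply: h2; rewrite tpos.
  - by rewrite f1 f2.
exact: normr_ge0.
Qed.

(** * Assembly of the inverse on the whole ball *)

Theorem corollary4p7 (n : nat) (f : 'cV[R]_n -> 'cV[R]_n)
    (Jf : 'cV[R]_n -> set 'M[R]_n) (x0 : 'cV[R]_n) (rho : R)
    (eta : R -> R) (sigma : R)
    (f_cont : continuous f)
    (Jf_pj : pseudo_jacobian_map f Jf)
    (Jf_usc : forall x, usc_at Jf x)
    (rho_gt0 : 0 < rho)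
    (eta_bound : forall t : R, 0 <= t < rho ->
       0 < eta t /\
       ((eta t)%:E <=
        ereal_inf [set regularity_index Jf x | x in
                     [set x : 'cV[R]_n | enorm (x - x0) = t]])%E)
    (eta_int : is_Riemann_integral_co eta 0%R rho sigma) :
  eball (f x0) sigma `<=` f @` eball x0 rho /\
  has_local_inverse_on f x0 (eball (f x0) sigma).
Proof.
have eta_gt0 t : 0 <= t < rho -> 0 < eta t by move=> /eta_bound[].
have sigma_gt0 : 0 < sigma by exact: integral_gt0 eta_int.
have index_ge x : enorm (x - x0) < rho ->
    ((eta (enorm (x - x0)))%:E <= regularity_index Jf x)%E.
  move=> xr; have [|_] := eta_bound (enorm (x - x0)); first by rewrite enorm_ge0.
  by move/le_trans; apply; apply: ereal_inf_lbound; exists x.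
have loc_inj x : enorm (x - x0) < rho -> exists2 d, 0 < d &
    forall p q, `|p - x| < d -> `|q - x| < d -> f p = f q -> p = q.
  move=> xr; have e0 : 0 < eta (enorm (x - x0)) by apply: eta_gt0; rewrite enorm_ge0.
  have e2 : 0 < eta (enorm (x - x0)) / 2 by rewrite divr_gt0.
  have [|d d0 fexp] := @expands_near n f Jf x (eta (enorm (x - x0)) / 2)%R _
    f_cont Jf_pj (Jf_usc x) (index_ge x xr) e0; first lra.
  by exists d => // p q; exact: expands_inj fexp.
set y0 := f x0.
have lift r : 0 < r < sigma -> exists g, g y0 = x0 /\ forall y, enorm (y - y0) < r ->
    [/\ f (g y) = y, enorm (g y - x0) < rho & {for y, continuous g}].
  move=> /andP[r0 rs].
  have [t [Psi [/andP[t0 tr] Psi0 Psi_homo rPsi slope]]] :=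
    slope_function eta_int rho_gt0 rs eta_gt0.
  have [||g [g0 hg]] := @lift_ball n f Psi x0 t r f_cont Psi_homo Psi0.
  - move=> x xt; have xr : enorm (x - x0) < rho by apply: le_lt_trans tr.
    have [|a /andP[a0 ae] [d d0 hd]] := slope (enorm (x - x0)).
      by rewrite enorm_ge0.
    (* A midpoint is positive even when [a] is 0, dominates the slope of [Psi], and stays strictly
       below the index bound, as local expansion requires. *)
    pose a' := (a + eta (enorm (x - x0))) / 2.
    have a'e : a' < eta (enorm (x - x0)) by rewrite /a'; lra.
    have aa' : a <= a' by rewrite /a'; lra.
    have a'0 : 0 < a' by rewrite /a'; lra.
    have [|d' d'0 fexp] := @expands_near n f Jf x a' _
      f_cont Jf_pj (Jf_usc x) (index_ge x xr) _ a'e; first lra.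
    pose dm := Num.min d' (d / n.+1%:R).
    have dm0 : 0 < dm by rewrite lt_min d'0 divr_gt0.
    exists a', dm; split=> //; split.
      move=> u; have [v v1 hv] := fexp u; exists v => // p px pux.
      by apply: hv; [move: px|move: pux]; rewrite lt_min => /andP[].
    have near p : `|p - x| < dm -> `|enorm (p - x0) - enorm (x - x0)| < d.
      rewrite lt_min ltr_pdivlMr // => /andP[_].
      have := enorm_lip (p - x0) (x - x0); rewrite opprB addrA subrK.
      by rewrite mulrC; exact: le_lt_trans.
    move=> p q /near px /near qx.
    have := enorm_distD q p x0 => pq; have pq0 := enorm_ge0 (p - q).
    (* Only an outward displacement needs the slope bound; otherwise monotonicity makes the
       increment of [Psi] nonpositive. *)
    have [le|lt] := leP (enorm (q - x0)) (enorm (p - x0)).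
      apply: le_trans (hd _ _ qx px le) _.
      apply: (@le_trans _ _ (a * enorm (p - q))); last exact: ler_wpM2r.
      by apply: ler_wpM2l => //; lra.
    have := Psi_homo _ _ (ltW lt).
    have : 0 <= a' * enorm (p - q) by rewrite mulr_ge0 // ltW.
    lra.
  - by rewrite r0.
  exists g; split=> // y yr; have [h1 h2 h3] := hg y yr; split=> //.
  exact: lt_trans tr.
have lift' r : exists g, 0 < r < sigma -> g y0 = x0 /\ forall y, enorm (y - y0) < r ->
    [/\ f (g y) = y, enorm (g y - x0) < rho & {for y, continuous g}].
  by have [/lift[g hg]|/negP nr] := boolP (0 < r < sigma); [exists g|exists f].
have [gr hgr] := choice lift'.
have mid y : enorm (y - y0) < sigma -> 0 < (enorm (y - y0) + sigma) / 2 < sigma.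
  by move=> ys; have := enorm_ge0 (y - y0); lra.
(* The radius depends on [y]: any value strictly between [enorm (y - y0)] and [sigma] would do,
   since [gE] shows that the result is independent of it. *)
pose g y := gr ((enorm (y - y0) + sigma) / 2)%R y.
have gE r y : 0 < r < sigma -> enorm (y - y0) < r -> g y = gr r y.
  move=> rs yr; have ys : enorm (y - y0) < sigma by apply: lt_trans yr _; case/andP: rs.
  have rs' := mid y ys; set r' := (_ / 2) in rs'.
  have [g0 hg] := hgr r rs; have [g'0 hg'] := hgr r' rs'.
  apply: (@sections_agree n f (gr r') (gr r) y0 (Num.min r r')); last first.
  - by rewrite lt_min yr /r'; have := enorm_ge0 (y - y0); lra.
  - by rewrite g0 g'0.
  move=> z; rewrite lt_min => /andP[/hg[f1 _ c1] /hg'[f2 g2x c2]].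
  by split=> //; exact: loc_inj.
have gP y : enorm (y - y0) < sigma ->
    [/\ f (g y) = y, enorm (g y - x0) < rho & {for y, continuous g}].
  move=> ys; have rs := mid y ys; set r := (_ / 2) in rs.
  have yr : enorm (y - y0) < r by rewrite /r; lra.
  have [_ /(_ y yr)[h1 h2 /continuousP_lt h3]] := hgr r rs.
  rewrite (gE r) //; split=> //; apply/continuousP_lt => e /h3[d d0 hd].
  (* Points this close to [y] stay in the ball of radius [r], where [g] is the single continuous
     section [gr r]. *)
  pose d1 := (r - enorm (y - y0)) / n.+1%:R.
  have d10 : 0 < d1 by rewrite divr_gt0 // subr_gt0.
  exists (Num.min d d1); first by rewrite lt_min d0.
  move=> z; rewrite lt_min ltr_pdivlMr // mulrC => /andP[/hd zy zd].
  rewrite (gE r y) // (gE r z) //; apply: le_lt_trans (enorm_distD y _ _) _.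
  have := enorm_le_norm (z - y); lra.
split.
  by move=> y /gP[fg gx _]; exists (g y).
have y00 : enorm (y0 - y0) < sigma by rewrite subrr enorm0.
have g0 : g y0 = x0.
  have rs := mid y0 y00; have [g0 _] := hgr _ rs; exact: g0.
have [|d d0 inj] := loc_inj x0; first by rewrite subrr enorm0.
have [_ _ /continuousP_lt/(_ _ d0)[c c0 hc]] := gP y0 y00.
have s1 : 0 < sigma / n.+1%:R by rewrite divr_gt0.
have /continuousP_lt/(_ (Num.min c (sigma / n.+1%:R))) := f_cont x0.
rewrite lt_min c0 => /(_ s1)[b b0 hb].
have fV x : `|x - x0| < b -> `|f x - y0| < c /\ enorm (f x - y0) < sigma.
  move=> /hb; rewrite lt_min ltr_pdivlMr // mulrC => /andP[h1 h2]; split=> //.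
  exact: le_lt_trans (enorm_le_norm _) h2.
(* The radius [b] sends [x] into the ball [V] and so close to [y0] that [g (f x)] is within [d] of
   [x0]; [x] is also within [d], and injectivity there identifies the two. *)
exists [set x | `|x - x0| < Num.min b d], g; split.
- apply/(@nbhs_normP R 'cV[R]_n); exists (Num.min b d); first by rewrite /= lt_min b0.
  by move=> x; rewrite /ball_ /= distrC.
- by apply: continuous_in_subspaceT => y; rewrite inE => /gP[].
- by move=> _ [x /= xb <-]; move: xb; rewrite lt_min => /andP[/fV[]].
- move=> x /=; rewrite lt_min => /andP[/fV[fxc fxs] xd].
  have [fgf _ _] := gP _ fxs; apply: inj => //.
  by rewrite -g0; exact: hc.
- by move=> y /gP[].
Qed.
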